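(* If $y$ is an element of the Doob--Martin boundary of the Rémy chain, then the corresponding nonnegative harmonic function $K(\cdot,y)$ is extremal, i.e. is an extreme point of the convex set of nonnegative harmonic functions for the Rémy chain that take the value $1$ at $\aleph$; equivalently, the infinite Rémy bridge corresponding to $y$ is extremal. There is thus a bijective correspondence between the Doob--Martin boundary of the Rémy chain and the set of (distributions of) extremal infinite Rémy bridges, given by associating with $y$ the infinite Rémy bridge corresponding to $y$.
   Context: $\mathbb N=\{1,2,\dots\}$. A binary tree is a finite rooted planar tree in which every vertex has zero or two children, left and right children being distinguished; it has $n+1$ leaves and $2n+1$ vertices for some $n$. $\aleph$ is the unique binary tree with 3 vertices. Rémy chain $(T_n)_{n\in\mathbb N}$: the Markov chain with $T_1=\aleph$ in which $T_{n+1}$ is obtained from $T_n$ by picking a vertex $v$ of $T_n$ uniformly at random, cutting off the subtree rooted at $v$, attaching a copy of $\aleph$ at the place where $v$ was, and re-attaching the cut-off subtree to one of the two leaves of the copy of $\aleph$, chosen uniformly at random. Let $P$ be its transition matrix on the set $E$ of binary trees with at least 3 vertices. A function $h:E\to\mathbb R_+$ is harmonic if $\sum_{\mathbf t}P(\mathbf s,\mathbf t)h(\mathbf t)=h(\mathbf s)$ for all $\mathbf s$. Doob--Martin boundary: let $p(\mathbf s,\mathbf t)$ be the probability that the chain started at $\mathbf s$ ever hits $\mathbf t$, and $K(\mathbf s,\mathbf t)=p(\mathbf s,\mathbf t)/p(\aleph,\mathbf t)$. Identify $E$ with $\{K(\cdot,\mathbf t):\mathbf t\in E\}\subset\mathbb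 R_+^E$ (product topology). The closure $\bar E$ is the Doob--Martin compactification, $\partial E=\bar E\setminus E$ is the Doob--Martin boundary, and each $K(\mathbf s,\cdot)$ extends continuously to $\bar E$; for $y\in\partial E$, $K(\cdot,y)$ is harmonic with $K(\aleph,y)=1$. An infinite Rémy bridge is a Markov process $(T_n^\infty)_{n\in\mathbb N}$ of binary trees, $T_n^\infty$ having $2n+1$ vertices, with $T_1^\infty=\aleph$ and the same backward transition probabilities $\mathbb P\{T_n=\mathbf s\mid T_{n+1}=\mathbf t\}$ as the Rémy chain. It is extremal if its tail $\sigma$-field $\bigcap_m\sigma\{T_n^\infty:n\ge m\}$ is $\mathbb P$-trivial. The infinite Rémy bridge corresponding to $y\in\partial E$ is the Doob $h$-transform of the Rémy chain started at $\aleph$ with $h=K(\cdot,y)$, i.e. the Markov chain with transition probabilities $h(\mathbf s)^{-1}P(\mathbf s,\mathbf t)h(\mathbf t)$ on $\{h>0\}$. *)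

(* Defs.v *)
From HB Require Import structures.
From mathcomp Require Import all_boot all_order all_algebra.
From mathcomp Require Import all_classical all_reals all_analysis.

Set Implicit Arguments.
Unset Strict Implicit.
Unset Printing Implicit Defensive.
Import Order.TTheory GRing.Theory Num.Theory.
Import numFieldNormedType.Exports.
Local Open Scope classical_set_scope.
Local Open Scope ring_scope.

(** * Binary trees *)

Inductive btree : Type := Leaf | Branch (l r : btree).

Fixpoint btree_encode (t : btree) : GenTree.tree unit :=
  match t with
  | Leaf => GenTree.Leaf tt
  | Branch l r => GenTree.Node 0 [:: btree_encode l; btree_encode r]
  end.

Fixpoint btree_decode (g : GenTree.tree unit) : btree :=
  match g with
  | GenTree.Node _ [:: l; r] => Branch (btree_decode l) (btree_decode r)
  | _ => Leaf
  end.

Lemma btree_encodeK : cancel btree_encode btree_decode.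
Proof. by elim=> //= l -> r ->. Qed.

HB.instance Definition _ := Countable.copy btree (can_type btree_encodeK).

Fixpoint nb_vertices (t : btree) : nat :=
  match t with
  | Leaf => 1
  | Branch l r => (nb_vertices l + nb_vertices r).+1
  end.

(* The results of one step of Remy's algorithm, one entry (with repetitions)
   for each choice of a vertex [v] of [t] and of a side. The first two entries
   are those where [v] is the root. *)
Fixpoint remy_moves (t : btree) : seq btree :=
  [:: Branch t Leaf; Branch Leaf t] ++
  match t with
  | Leaf => [::]
  | Branch l r =>
      [seq Branch l' r | l' <- remy_moves l] ++
      [seq Branch l r' | r' <- remy_moves r]
  end.

Lemma size_remy_moves (t : btree) : size (remy_moves t) = (2 * nb_vertices t)%N.
Proof.
by elim: t => //= l IHl r IHr; rewrite size_cat !size_map IHl IHr -mulnDr mulnS.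
Qed.

(* The state space of the chain, denoted [E] in the comments below. *)
Definition remy_tree := {t : btree | (3 <= nb_vertices t)%N}.

Definition aleph : remy_tree := exist _ (Branch Leaf Leaf) isT.

HB.instance Definition _ := Countable.on remy_tree.
HB.instance Definition _ := isPointed.Build remy_tree aleph.
HB.instance Definition _ := @isMeasurable.Build default_measure_display
  remy_tree discrete_measurable discrete_measurable0
  discrete_measurableC discrete_measurableU.

(* All processes are indexed from [0]: [X n] stands for T_{n+1}, which has
   2(n+1)+1 vertices. *)
Definition cylinders : set (set (nat -> remy_tree)) :=
  [set A | exists n t, A = [set w | w n = t]].

(* As [E] is countable and discrete, this is the product sigma-algebra. *)
Definition path_space := g_sigma_algebraType cylinders.

Definition coord_process (n : nat) (w : path_space) : remy_tree := w n.

(** * Markov processes with values in [E] *)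

Section Processes.
Context (R : realType) (d : measure_display) (Omega : measurableType d).
Variables (P : probability Omega R) (X : nat -> Omega -> remy_tree).

Definition cond_pr (A B : set Omega) : R := fine (P (A `&` B)) / fine (P B).

Definition past (n : nat) (w : nat -> remy_tree) : set Omega :=
  [set o | forall i, (i <= n)%N -> X i o = w i].

Definition markov_process : Prop :=
  (forall n, measurable_fun setT (X n)) /\
  (forall n w t, P (past n w) != 0%E ->
     cond_pr [set o | X n.+1 o = t] (past n w) =
     cond_pr [set o | X n.+1 o = t] [set o | X n o = w n]).

Definition markov_chain (s0 : remy_tree) (Q : remy_tree -> remy_tree -> R) :
    Prop :=
  [/\ forall n, measurable_fun setT (X n),
      P [set o | X 0%N o = s0] = 1%E &
      forall n w t, P (past n w) != 0%E ->
        cond_pr [set o | X n.+1 o = t] (past n w) = Q (w n) t].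

(* The sigma-algebra generated by the [X n] with [n >= m]. *)
Definition sigma_from (m : nat) : set (set Omega) :=
  <<s [set A | exists n, (m <= n)%N /\ exists B, A = X n @^-1` B] >>.

Definition tail_sigma : set (set Omega) := \bigcap_m sigma_from m.

Definition tail_trivial : Prop :=
  forall A, tail_sigma A -> P A = 0%E \/ P A = 1%E.

(* The distribution of the process. It is restricted to the measurable sets
   because the values of a library measure on other sets are arbitrary. *)
Definition path_law (A : {A : set path_space | measurable A}) : \bar R :=
  P [set o | sval A (fun n => X n o)].

End Processes.

(* The law of the Markov chain started at [s0] with transition matrix [Q]; it
   exists (Ionescu-Tulcea), and is unique on measurable sets, whenever the rows
   of [Q] indexed by the states reachable from [s0] are probability vectors. *)
Definition chain_law (R : realType) (s0 : remy_tree)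
    (Q : remy_tree -> remy_tree -> R) : probability path_space R :=
  xget (dirac ((fun=> s0) : path_space) : probability path_space R)
    [set mu : probability path_space R | markov_chain mu coord_process s0 Q].

(** * The Remy chain and its Doob-Martin boundary *)

Section Remy.
Context (R : realType).

Definition remy_P (s t : remy_tree) : R :=
  (count_mem (sval t) (remy_moves (sval s)))%:R /
  (2 * nb_vertices (sval s))%:R.

Definition remy_law (s : remy_tree) : probability path_space R :=
  chain_law s remy_P.

(* The sum has finitely many nonzero terms. *)
Definition remy_harmonic (h : remy_tree -> R) : Prop :=
  forall s, \sum_(t \in [set: remy_tree]) (remy_P s t * h t) = h s.

Definition normalized_harmonic : set (remy_tree -> R) :=
  [set h | [/\ forall s, 0 <= h s, remy_harmonic h & h aleph = 1]].

Definition hit_pr (s t : remy_tree) : R :=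
  fine (remy_law s [set w | exists n, coord_process n w = t]).

Definition martin_kernel (s t : remy_tree) : R := hit_pr s t / hit_pr aleph t.

(* The copy {K(., t) : t in E} of [E] in R^E with the product topology. *)
Definition martin_embedding : set {ptws remy_tree -> R} :=
  [set (fun s => martin_kernel s t) | t in [set: remy_tree]].

(* A point [y] of the compactification is itself a function on [E], and the
   continuous extension of K(s, .) is evaluation at [s]: K(., y) is [y]. *)
Definition doob_martin_compactification : set {ptws remy_tree -> R} :=
  closure martin_embedding.

Definition doob_martin_boundary : set {ptws remy_tree -> R} :=
  doob_martin_compactification `\` martin_embedding.

Definition remy_backward (n : nat) (s t : remy_tree) : R :=
  cond_pr (remy_law aleph)
    [set w | coord_process n w = s] [set w | coord_process n.+1 w = t].

Definition infinite_remy_bridge d (Omega : measurableType d)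
    (P : probability Omega R) (X : nat -> Omega -> remy_tree) : Prop :=
  [/\ markov_process P X,
      P [set o | X 0%N o = aleph] = 1%E,
      forall n, {ae P, forall o, nb_vertices (sval (X n o)) = (2 * n.+1).+1} &
      forall n s t, P [set o | X n.+1 o = t] != 0%E ->
        cond_pr P [set o | X n o = s] [set o | X n.+1 o = t] =
        remy_backward n s t].

Definition extremal_bridge d (Omega : measurableType d)
    (P : probability Omega R) (X : nat -> Omega -> remy_tree) : Prop :=
  infinite_remy_bridge P X /\ tail_trivial P X.

Definition extremal_bridge_laws :
    set ({A : set path_space | measurable A} -> \bar R) :=
  [set l | exists d (Omega : measurableType d) (P : probability Omega R)
             (X : nat -> Omega -> remy_tree),
             extremal_bridge P X /\ l = path_law P X].

(* Started at a state where [h > 0], the chain with this matrix stays in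
   [{h > 0}], so that the value of [(h s)^-1] when [h s = 0] plays no role. *)
Definition htransform (h : remy_tree -> R) (s t : remy_tree) : R :=
  (h s)^-1 * remy_P s t * h t.

(* The infinite Remy bridge corresponding to [y], as the coordinate process
   on the path space with this probability. *)
Definition bridge_of (y : remy_tree -> R) : probability path_space R :=
  chain_law aleph (htransform y).

End Remy.

Arguments normalized_harmonic : clear implicits.
Arguments doob_martin_boundary : clear implicits.
Arguments extremal_bridge_laws : clear implicits.

Definition extreme_point (R : realType) (V : lmodType R) (C : set V) (x : V) :
    Prop :=
  C x /\
  forall (a b : V) (u : R), C a -> C b -> 0 < u < 1 ->
    x = u *: a + (1 - u) *: b -> a = x /\ b = x.

(* Main.v *)
From HB Require Import structures.
Require Import Defs.
From mathcomp Require Import all_boot all_order all_algebra.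
From mathcomp Require Import all_classical all_reals all_analysis.
From mathcomp Require Import ring lra zify.
Set Implicit Arguments.
Unset Strict Implicit.
Unset Printing Implicit Defensive.
Import Order.TTheory GRing.Theory Num.Theory.
Import numFieldNormedType.Exports.
Local Open Scope classical_set_scope.
Local Open Scope ring_scope.

(* Read backwards, the Remy chain deletes a uniformly chosen leaf, so K(s, t) is,
   up to a constant depending on s only, the probability that successive leaf
   deletions lead from t to s. For a function f of trees with m leaves, let f_n
   be its iterated average over leaf deletions, on trees with n leaves. Two
   deletions commute, hence f_n changes by at most m/n when another leaf of the
   same tree is deleted, and the variance of f_n(T_n) given T_N is at most
   m^2/n, uniformly in N. Passing to the limit along T_N = t_k, for the bridge
   of a boundary point y the variables f_n(T_n) concentrate at their mean. If
   y = u a + (1 - u) b, then the laws of the a-bridge are dominated by those of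
   the y-bridge divided by u, so f_n(T_n) concentrates at the same value under
   both, and a = y. Extremality gives tail triviality, since conditioning on a
   tail event again produces a harmonic function. Conversely f_n(T_n) is a
   bounded reverse martingale under any bridge, so if the tail is trivial it
   converges to a constant; hence trees t with all the K(s, t) close to
   y(s) exist, and y is in the boundary. *)

(** * Deletion of leaves *)

(** Insertion and deletion of a marked leaf are inverse to each other, so trees of one size are
    equally likely under the chain, and its transition operator is adjoint to averaging over leaf
    deletions. Expectations under a bridge thus become finite sums over one [level]; measure theory
    enters only through hitting probabilities and tail events. The variance bound is uniform in N
    because one deletion at size n contributes O(m^2/n^2), which is summable. Boundary points are
    limits of trees of unbounded size because each size has finitely many trees. In the converse,
    the constant limit is located by a zero-one law: the events that the martingale is infinitely
    often at most q, along a fast sequence of times, are tail events, and the limit is the value of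
    q where their probability passes from 0 to 1. Since [chain_law] is a choice, a chain with a
    given matrix is built from one uniform variable before its law can be used. *)

Fixpoint leaves (t : btree) : nat :=
  match t with Leaf => 1 | Branch l r => (leaves l + leaves r)%N end.

Lemma leaves_gt0 t : (0 < leaves t)%N.
Proof. by elim: t => //= l IHl r IHr; rewrite ltn_addr. Qed.

Lemma nb_verticesE t : (nb_vertices t).+1 = (2 * leaves t)%N.
Proof. by elim: t => //= l IHl r IHr; lia. Qed.

Lemma leaves1 t : leaves t = 1%N -> t = Leaf.
Proof.
by case: t => //= l r; have := leaves_gt0 l; have := leaves_gt0 r; lia.
Qed.

(* Leaves are numbered from the left; the sibling subtree takes the place of
   the parent of the deleted leaf. *)
Fixpoint del (t : btree) (i : nat) : btree :=
  match t with
  | Leaf => Leaf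
  | Branch l r =>
      if (i < leaves l)%N then
        if l is Leaf then r else Branch (del l i) r
      else if r is Leaf then l else Branch l (del r (i - leaves l))
  end.

Lemma del_branchl l r i : (i < leaves l)%N -> (1 < leaves l)%N ->
  del (Branch l r) i = Branch (del l i) r.
Proof. by move=> il l1; rewrite /= il; case: l il l1. Qed.

Lemma del_branchr l r i : (leaves l <= i)%N -> (1 < leaves r)%N ->
  del (Branch l r) i = Branch l (del r (i - leaves l)).
Proof. by move=> il r1; rewrite /= ltnNge il; case: r r1. Qed.

Lemma del_branch_leafr l i : (leaves l <= i)%N -> del (Branch l Leaf) i = l.
Proof. by move=> il; rewrite /= ltnNge il. Qed.

Lemma leaves_branch l r : leaves (Branch l r) = (leaves l + leaves r)%N.
Proof. by []. Qed.

(** The maximum accounts for the single leaf, which [del] fixes. *)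
Lemma leaves_del t i : (i < leaves t)%N -> leaves (del t i) = maxn 1 (leaves t).-1.
Proof.
elim: t i => // l IHl r IHr i; rewrite leaves_branch => ilt.
have l0 := leaves_gt0 l; have r0 := leaves_gt0 r.
have [il|il] := ltnP i (leaves l).
  have [l1|l1] := ltnP 1 (leaves l).
    by rewrite del_branchl // leaves_branch IHl //; lia.
  have lE : l = Leaf by apply: leaves1; lia.
  by rewrite lE in il *; rewrite /= il; lia.
have [r1|r1] := ltnP 1 (leaves r).
  by rewrite del_branchr // leaves_branch IHr //; lia.
have -> : r = Leaf by apply: leaves1; lia.
by rewrite del_branch_leafr // /=; lia.
Qed.

(* The simplicial identity [d_i d_(j+1) = d_j d_i]. *)
Lemma del_comm t i j : (i <= j)%N -> (j.+1 < leaves t)%N -> (2 < leaves t)%N ->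
  del (del t j.+1) i = del (del t i) j.
Proof.
elim: t i j => // l IHl r IHr i j ij; rewrite leaves_branch => jlt t3.
have l0 := leaves_gt0 l; have r0 := leaves_gt0 r.
have [jl|jl] := ltnP j.+1 (leaves l).
  have il : (i < leaves l)%N by lia.
  have Hj := leaves_del jl; have Hi := leaves_del il.
  rewrite !(@del_branchl l) //; try lia.
  have [l3|l3] := ltnP 2 (leaves l).
    by rewrite !del_branchl ?Hi ?Hj ?IHl //; lia.
  have -> : del l i = Leaf by apply: leaves1; lia.
  have -> : del l j.+1 = Leaf by apply: leaves1; lia.
  have -> : i = 0%N by lia.
  by have -> : j = 0%N by lia.
(* If [i] is in [l], the two leaves lie in different subtrees and the deletions do not interact,
   except that a subtree with a single leaf disappears and its sibling moves up. *)
have [il|il] := ltnP i (leaves l).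
  have [r1|r1] := ltnP 1 (leaves r).
    rewrite (@del_branchr _ _ j.+1) //.
    have [l1|l1] := ltnP 1 (leaves l).
      have Hi := leaves_del il.
      rewrite !(@del_branchl l) // del_branchr // Hi; try lia.
      by congr (Branch _ (del _ _)); lia.
    have lE : l = Leaf by apply: leaves1; lia.
    by rewrite lE in il jl *; rewrite /= il subn1.
  have rE : r = Leaf by apply: leaves1; lia.
  rewrite rE in jlt t3 *; rewrite /= in jlt t3.
  rewrite (@del_branch_leafr _ j.+1) // del_branchl //; try lia.
  by rewrite del_branch_leafr // leaves_del //; lia.
have r1 : (1 < leaves r)%N by lia.
rewrite !(@del_branchr l r) //.
have Hj : leaves (del r (j.+1 - leaves l)) = maxn 1 (leaves r).-1.
  by apply: leaves_del; lia.
have Hi : leaves (del r (i - leaves l)) = maxn 1 (leaves r).-1.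
  by apply: leaves_del; lia.
have [r3|r3] := ltnP 2 (leaves r).
  rewrite !del_branchr ?Hi ?Hj; try lia.
  have -> : (j.+1 - leaves l = (j - leaves l).+1)%N by lia.
  by rewrite IHr //; lia.
have -> : del r (j.+1 - leaves l) = Leaf by apply: leaves1; lia.
have -> : del r (i - leaves l) = Leaf by apply: leaves1; lia.
by rewrite !del_branch_leafr //; lia.
Qed.

Lemma mem_remy_moves s t : t \in remy_moves s -> leaves t = (leaves s).+1.
Proof.
elim: s t => [|l IHl r IHr] t; first by rewrite !inE => /orP[] /eqP ->.
rewrite /= !inE => /or3P[/eqP->|/eqP->|]; rewrite /= ?addn1 ?add1n //.
rewrite mem_cat => /orP[] /mapP[u /[swap] ->].
  by move=> /IHl; rewrite /= => ->; lia.
by move=> /IHr; rewrite /= => ->; lia.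
Qed.

Definition dels (t : btree) := [seq del t i | i <- iota 0 (leaves t)].

Lemma dels_branch a b : dels (Branch a b) =
  (if a is Leaf then [:: b] else [seq Branch a' b | a' <- dels a]) ++
  (if b is Leaf then [:: a] else [seq Branch a b' | b' <- dels b]).
Proof.
rewrite /dels leaves_branch iotaD map_cat add0n; congr (_ ++ _).
  case: (ltnP 1 (leaves a)) => a1; last first.
    by have -> : a = Leaf by (apply: leaves1; have := leaves_gt0 a; lia).
  have -> : [seq del (Branch a b) i | i <- iota 0 (leaves a)] =
      [seq Branch a' b | a' <- [seq del a i | i <- iota 0 (leaves a)]].
    rewrite -map_comp; apply/eq_in_map => i; rewrite mem_iota add0n => ia.
    exact: del_branchl.
  by case: a a1.
have -> : iota (leaves a) (leaves b) = [seq leaves a + i | i <- iota 0 (leaves b)]%N.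
  by rewrite -iotaDl addn0.
case: (ltnP 1 (leaves b)) => b1; last first.
  have -> : b = Leaf by (apply: leaves1; have := leaves_gt0 b; lia).
  by rewrite /= ltnNge addn0 leqnn.
rewrite -map_comp.
have -> : [seq (del (Branch a b) \o addn (leaves a)) i | i <- iota 0 (leaves b)] =
    [seq Branch a b' | b' <- [seq del b i | i <- iota 0 (leaves b)]].
  rewrite -map_comp; apply/eq_in_map => i; rewrite mem_iota add0n => ib.
  by rewrite [LHS](@del_branchr a b) ?leq_addr // addKn.
by case: b b1.
Qed.

Lemma count_branchl (s r : btree) (x : seq btree) :
  count_mem s [seq Branch a r | a <- x] =
  (if s is Branch s1 s2 then (s2 == r) * count_mem s1 x else 0)%N.
Proof.
rewrite count_map; case: s => [|s1 s2]; first by rewrite -[RHS](count_pred0 x); apply: eq_count.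
have [->|ne] := eqVneq s2 r.
  by rewrite mul1n; apply: eq_count => a /=; apply/eqP/eqP => [[]|->].
rewrite mul0n -[RHS](count_pred0 x); apply: eq_count => a /=.
by apply/eqP => -[_ e]; rewrite e eqxx in ne.
Qed.

Lemma count_branchr (s l : btree) (x : seq btree) :
  count_mem s [seq Branch l a | a <- x] =
  (if s is Branch s1 s2 then (s1 == l) * count_mem s2 x else 0)%N.
Proof.
rewrite count_map; case: s => [|s1 s2]; first by rewrite -[RHS](count_pred0 x); apply: eq_count.
have [->|ne] := eqVneq s1 l.
  by rewrite mul1n; apply: eq_count => a /=; apply/eqP/eqP => [[]|->].
rewrite mul0n -[RHS](count_pred0 x); apply: eq_count => a /=.
by apply/eqP => -[e _]; rewrite e eqxx in ne.
Qed.

Lemma branch_eq a b c d : (Branch a b == Branch c d) = (a == c) && (b == d).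
Proof. by apply/eqP/andP => [[-> ->]|[/eqP -> /eqP ->]]. Qed.

Lemma count_leaf_moves s : count_mem Leaf (remy_moves s) = 0%N.
Proof.
by apply/count_memPn/negP => /mem_remy_moves /=; have := leaves_gt0 s; lia.
Qed.

Lemma remy_moves_branch l r : remy_moves (Branch l r) =
  [:: Branch (Branch l r) Leaf; Branch Leaf (Branch l r)] ++
  ([seq Branch l' r | l' <- remy_moves l] ++
   [seq Branch l r' | r' <- remy_moves r]).
Proof. by []. Qed.

(* Inserting a leaf and marking it is inverse to deleting a marked leaf. *)
Lemma count_moves_dels s t : (1 < leaves t)%N ->
  count_mem t (remy_moves s) = count_mem s (dels t).
Proof.
elim: s t => [|l IHl r IHr] [//|a b] _.
  rewrite dels_branch /= !branch_eq.
  by case: a => [|a1 a2]; case: b => [|b1 b2] //; rewrite count_cat ?(count_branchl Leaf) ?(count_branchr Leaf).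
rewrite dels_branch [RHS]count_cat remy_moves_branch !count_cat count_branchl count_branchr /= addn0.
have IHl' x : x != Leaf -> count_mem x (remy_moves l) = count_mem l (dels x).
  by move=> ne; apply: IHl; case: x ne => //= u v _; rewrite -addn1 leq_add ?leaves_gt0.
have IHr' x : x != Leaf -> count_mem x (remy_moves r) = count_mem r (dels x).
  by move=> ne; apply: IHr; case: x ne => //= u v _; rewrite -addn1 leq_add ?leaves_gt0.
rewrite !branch_eq.
(* The two terms exclude each other: no insertion produces a single leaf, so the second one vanishes
   when [a] is a leaf. *)
have -> : count_mem (Branch l r) (if a is Leaf then [:: b] else [seq Branch a' b | a' <- dels a])
   = ((a == Leaf) * (b == Branch l r) + (b == r) * count_mem a (remy_moves l))%N.
  case: a => [|a1 a2].
    by rewrite count_leaf_moves muln0 eqxx mul1n addn0 /= addn0.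
  by rewrite count_branchl IHl' // eq_sym.
have -> : count_mem (Branch l r) (if b is Leaf then [:: a] else [seq Branch a b' | b' <- dels b])
   = ((b == Leaf) * (a == Branch l r) + (a == l) * count_mem b (remy_moves r))%N.
  case: b => [|b1 b2].
    by rewrite count_leaf_moves muln0 eqxx mul1n addn0 /= addn0.
  by rewrite count_branchr IHr' // [l == a]eq_sym.
by rewrite [Branch l r == a]eq_sym [Branch l r == b]eq_sym [Leaf == a]eq_sym [Leaf == b]eq_sym; case: (a == Leaf); case: (b == Leaf); case: (a == Branch l r); case: (b == Branch l r) => /=; lia.
Qed.

(** * The forward and backward operators *)

Definition nleaves (t : remy_tree) : nat := leaves (sval t).

Lemma nleaves_ge2 t : (1 < nleaves t)%N.
Proof. by case: t => t; rewrite /nleaves /= => h; have := nb_verticesE t; lia. Qed.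

Lemma leaves2 (t : btree) : leaves t = 2%N -> t = Branch Leaf Leaf.
Proof.
case: t => [|l r] //=; have := leaves_gt0 l; have := leaves_gt0 r => r0 l0 h.
have -> : l = Leaf by apply: leaves1; lia.
by have -> : r = Leaf by apply: leaves1; lia.
Qed.

Lemma nleaves_aleph : nleaves aleph = 2%N.
Proof. by []. Qed.

Lemma nleaves2 t : nleaves t = 2%N -> t = aleph.
Proof. by move=> h; apply: val_inj; apply: leaves2. Qed.

(** The single leaf is not a state and is sent to [aleph]; in particular [rem_leaf] fixes
    [aleph]. *)
Definition rembed (b : btree) : remy_tree := insubd (aleph : {t : btree | (3 <= nb_vertices t)%N}) b.

Lemma rembedK (b : btree) : (1 < leaves b)%N -> sval (rembed b) = b.
Proof.
move=> b1; have h : (3 <= nb_vertices b)%N by have := nb_verticesE b; lia.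
exact: (insubdK (aleph : {t : btree | (3 <= nb_vertices t)%N}) h).
Qed.

Definition rem_leaf (t : remy_tree) (i : nat) : remy_tree := rembed (del (sval t) i).

Lemma sval_rem_leaf t i : (2 < nleaves t)%N -> (i < nleaves t)%N -> sval (rem_leaf t i) = del (sval t) i.
Proof.
by move=> t2 it; rewrite /rem_leaf rembedK // leaves_del //; move: t2; rewrite /nleaves; lia.
Qed.

Lemma nleaves_rem_leaf t i : (2 < nleaves t)%N -> (i < nleaves t)%N -> nleaves (rem_leaf t i) = (nleaves t).-1.
Proof.
move=> t2 it; rewrite /nleaves sval_rem_leaf // leaves_del //.
by move: t2; rewrite /nleaves; lia.
Qed.

Lemma rem_leaf_comm t i j : (i <= j)%N -> (j.+1 < nleaves t)%N -> (3 < nleaves t)%N ->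
  rem_leaf (rem_leaf t j.+1) i = rem_leaf (rem_leaf t i) j.
Proof.
move=> ij jt t3; have t2 : (2 < nleaves t)%N by lia.
have it : (i < nleaves t)%N by lia.
by rewrite /rem_leaf -![rembed (del (sval t) _)]/(rem_leaf t _) !sval_rem_leaf // del_comm.
Qed.

Definition rmoves (s : remy_tree) : seq remy_tree := map rembed (remy_moves (sval s)).

Lemma map_sval_rmoves s : map sval (rmoves s) = remy_moves (sval s).
Proof.
rewrite /rmoves -map_comp -[RHS]map_id; apply/eq_in_map => b /mem_remy_moves h.
by rewrite /= rembedK // h; have := nleaves_ge2 s; rewrite /nleaves; lia.
Qed.

Lemma mem_rmoves s t : t \in rmoves s -> nleaves t = (nleaves s).+1.
Proof.
move=> h; have : sval t \in map sval (rmoves s) by apply: map_f.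
by rewrite map_sval_rmoves => /mem_remy_moves.
Qed.

Lemma count_map_sval (t : remy_tree) (l : seq remy_tree) :
  count_mem (sval t) (map sval l) = count_mem t l.
Proof.
by rewrite count_map; apply: eq_count => u /=; apply/eqP/eqP => [/val_inj|->].
Qed.

Definition rem_leaves (t : remy_tree) := [seq rem_leaf t i | i <- iota 0 (nleaves t)].

Lemma count_rmoves s t : (2 < nleaves t)%N -> count_mem t (rmoves s) = count_mem s (rem_leaves t).
Proof.
move=> t2; rewrite -!count_map_sval map_sval_rmoves count_moves_dels; last exact: nleaves_ge2.
congr (count_mem _ _); rewrite /rem_leaves -map_comp; apply/eq_in_map => i.
by rewrite mem_iota add0n => it /=; rewrite sval_rem_leaf.
Qed.

(* The states of the chain at time [n] of the path, with [n + 2] leaves. *)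
Fixpoint level (n : nat) : seq remy_tree :=
  if n is n'.+1 then undup (flatten [seq rmoves s | s <- level n']) else [:: aleph].

Lemma level_uniq n : uniq (level n).
Proof. by case: n => //= n; apply: undup_uniq. Qed.

(** Every tree is reached by the chain: it is one move away from the tree obtained by deleting any
    of its leaves. *)
Lemma mem_level n t : (t \in level n) = (nleaves t == n.+2).
Proof.
elim: n t => [|n IH] t.
  by rewrite inE; apply/eqP/eqP => [->|/nleaves2].
rewrite /= mem_undup; apply/flattenP/eqP => [[_ /mapP[s + ->]]|h].
  by rewrite IH => /eqP h /mem_rmoves ->; rewrite h.
have t2 : (2 < nleaves t)%N by lia.
exists (rmoves (rem_leaf t 0)).
  by apply: map_f; rewrite IH nleaves_rem_leaf //; lia.
rewrite -has_pred1 has_count count_rmoves // -has_count has_pred1.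
by apply: map_f; rewrite mem_iota; lia.
Qed.

Arguments level : simpl never.

Lemma mem_level_nleaves t : t \in level (nleaves t - 2).
Proof. by rewrite mem_level; have := nleaves_ge2 t; lia. Qed.

Section Operators.
Context (R : realType).
Implicit Types (f g h : remy_tree -> R) (s t : remy_tree).

Lemma sum_count (T : choiceType) (l L : seq T) (f : T -> R) : uniq L -> {subset l <= L} ->
  \sum_(x <- l) f x = \sum_(x <- L) (count_mem x l)%:R * f x.
Proof.
move=> uL; elim: l => [|x l IH] sub.
  by rewrite big_nil big1 // => y _; rewrite mul0r.
rewrite big_cons IH; last by move=> y yl; apply: sub; rewrite inE yl orbT.
under [RHS]eq_bigr => y _ do rewrite /= natrD mulrDl.
rewrite big_split /=; congr (_ + _).
rewrite (bigD1_seq x) //=; last by apply: sub; rewrite inE eqxx.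
by rewrite eqxx mul1r big1 ?addr0 // => y /negPf; rewrite eq_sym => ->; rewrite mul0r.
Qed.

(** The transition operator of the time-reversed chain, with matrix [backward_kernel]; [forward_op]
    is that of the Rémy chain itself. *)
Definition backward_op f t : R := (\sum_(i < nleaves t) f (rem_leaf t i)) / (nleaves t)%:R.
Definition forward_op f s : R := (\sum_(t <- rmoves s) f t) / (2 * nb_vertices (sval s))%:R.
Definition backward_kernel t s : R := (count_mem s (rem_leaves t))%:R / (nleaves t)%:R.

Lemma nleaves_neq0 t : (nleaves t)%:R != 0 :> R.
Proof. by rewrite pnatr_eq0; have := nleaves_ge2 t; lia. Qed.

Lemma nb_vertices_neq0 t : (2 * nb_vertices (sval t))%:R != 0 :> R.
Proof. by rewrite pnatr_eq0; have := nb_verticesE (sval t); have := leaves_gt0 (sval t); lia. Qed.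

Lemma remy_PE s t : remy_P R s t = (count_mem t (rmoves s))%:R / (2 * nb_vertices (sval s))%:R.
Proof. by rewrite /remy_P -count_map_sval map_sval_rmoves. Qed.

Lemma remy_P_ge0 s t : 0 <= remy_P R s t.
Proof. by rewrite divr_ge0. Qed.

Lemma remy_P_eq0 s t : t \notin rmoves s -> remy_P R s t = 0.
Proof. by move=> h; rewrite remy_PE (count_memPn h) mul0r. Qed.

Lemma remy_P_nleaves s t : remy_P R s t != 0 -> nleaves t = (nleaves s).+1.
Proof. by case: (boolP (t \in rmoves s)) => [/mem_rmoves//|/remy_P_eq0 ->]; rewrite eqxx. Qed.

Lemma backward_kernel_ge0 s t : 0 <= backward_kernel s t.
Proof. by rewrite divr_ge0. Qed.

Lemma forward_opE n f s : s \in level n -> forward_op f s = \sum_(t <- level n.+1) remy_P R s t * f t.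
Proof.
rewrite mem_level => /eqP sn; rewrite /forward_op (@sum_count _ _ (level n.+1)) ?level_uniq //.
  by rewrite mulr_suml; apply: eq_bigr => t _; rewrite remy_PE mulrAC.
by move=> t /mem_rmoves; rewrite mem_level sn => ->.
Qed.

Lemma backward_opE n f t : t \in level n.+1 -> backward_op f t = \sum_(s <- level n) backward_kernel t s * f s.
Proof.
rewrite mem_level => /eqP tn; rewrite /backward_op.
have -> : \sum_(i < nleaves t) f (rem_leaf t i) = \sum_(s <- rem_leaves t) f s.
  by rewrite /rem_leaves big_map -(big_mkord xpredT (fun i => f (rem_leaf t i))) /index_iota subn0.
rewrite (@sum_count _ _ (level n)) ?level_uniq //.
  by rewrite mulr_suml; apply: eq_bigr => s _; rewrite /backward_kernel mulrAC.
move=> s /mapP[i]; rewrite mem_iota add0n => it ->.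
by rewrite mem_level nleaves_rem_leaf //; lia.
Qed.

Lemma harmonicE h : remy_harmonic h <-> forall s, forward_op h s = h s.
Proof.
suff E s : \sum_(t \in [set: remy_tree]) (remy_P R s t * h t) = forward_op h s.
  by split=> H s; rewrite ?E -?H ?E.
rewrite (forward_opE _ (mem_level_nleaves s)) (@fsbigE _ _ _ _ _ (level (nleaves s - 2).+1)) ?level_uniq //.
  by apply: eq_bigl => t; rewrite in_setT.
move=> t _; apply: contraNeq; rewrite mulf_eq0 negb_or => /andP[/remy_P_nleaves st _].
by rewrite mem_level st; have := nleaves_ge2 s; lia.
Qed.

(* The common probability of the trees of level [n] under the law of the chain. *)
Fixpoint level_prob (n : nat) : R :=
  if n is n'.+1 then level_prob n' * n.+2%:R / (2 * (2 * n.+2 - 3))%:R else 1.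

Arguments level_prob : simpl never.

(** A tree with n+3 leaves arises in n+3 ways, one for each leaf, and each way is one of the 2(2n+3)
    equally likely moves from a tree with n+2 leaves. *)
Lemma level_probS n : level_prob n.+1 = level_prob n * n.+3%:R / (2 * (2 * n.+3 - 3))%:R.
Proof. by []. Qed.

Lemma level_prob_gt0 n : 0 < level_prob n.
Proof. by elim: n => [|n IH]; rewrite ?level_probS // !mulr_gt0 ?invr_gt0 ?ltr0n //; lia. Qed.

Lemma level_prob_neq0 n : level_prob n != 0.
Proof. exact/lt0r_neq0/level_prob_gt0. Qed.

(** By [count_rmoves] there are as many moves from [s] to [t] as deletions from [t] to [s]; the
    ratio of the two values of [level_prob] compensates the normalizations. *)
Lemma detailed_balance n s t : s \in level n -> t \in level n.+1 ->
  level_prob n * remy_P R s t = level_prob n.+1 * backward_kernel t s.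
Proof.
rewrite !mem_level => /eqP sn /eqP tn; rewrite remy_PE count_rmoves; last by lia.
have -> : nb_vertices (sval s) = (2 * n.+3 - 3)%N.
  by have := nb_verticesE (sval s); rewrite -/(nleaves s) sn; lia.
rewrite /backward_kernel tn level_probS.
have h1 : (2 * (2 * n.+3 - 3))%:R != 0 :> R by rewrite pnatr_eq0; lia.
have h2 : (n.+3)%:R != 0 :> R by rewrite pnatr_eq0.
move: h1 h2; move: (2 * (2 * n.+3 - 3))%:R (n.+3)%:R => X Y h1 h2.
by field; rewrite h1 h2.
Qed.

(** Detailed balance summed over all pairs of consecutive states. *)
Lemma adjoint n f g : \sum_(s <- level n) level_prob n * f s * forward_op g s =
  \sum_(t <- level n.+1) level_prob n.+1 * backward_op f t * g t.
Proof.
rewrite big_seq; under eq_bigr => s sn do rewrite (forward_opE _ sn) mulr_sumr big_seq.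
rewrite -big_seq; rewrite [RHS]big_seq; under [RHS]eq_bigr => t tn do rewrite (backward_opE _ tn) mulr_sumr mulr_suml big_seq.
rewrite -[RHS]big_seq /= .
under eq_bigr do rewrite -big_seq.
under [RHS]eq_bigr do rewrite -big_seq.
rewrite exchange_big /=; rewrite big_seq [RHS]big_seq; apply: eq_bigr => t tn.
rewrite big_seq [RHS]big_seq; apply: eq_bigr => s sn.
transitivity ((level_prob n * remy_P R s t) * f s * g t); first by ring.
by rewrite (detailed_balance sn tn); ring.
Qed.

Lemma backward_op_ext n f g t : t \in level n.+1 -> {in level n, f =1 g} -> backward_op f t = backward_op g t.
Proof.
move=> tn fg; rewrite !(backward_opE _ tn) big_seq [RHS]big_seq.
by apply: eq_bigr => s sn; rewrite fg.
Qed.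

Lemma backward_op_cst c t : backward_op (fun=> c) t = c.
Proof.
by rewrite /backward_op sumr_const card_ord -[c *+ _]mulr_natr mulfK ?nleaves_neq0.
Qed.

Lemma backward_op_le n f g t : t \in level n.+1 -> {in level n, forall s, f s <= g s} -> backward_op f t <= backward_op g t.
Proof.
move=> tn fg; rewrite !(backward_opE _ tn) big_seq [X in _ <= X]big_seq.
by apply: ler_sum => s sn; rewrite ler_wpM2l ?backward_kernel_ge0 ?fg.
Qed.

Lemma backward_opD f g t : backward_op (fun s => f s + g s) t = backward_op f t + backward_op g t.
Proof. by rewrite /backward_op big_split mulrDl. Qed.

Lemma backward_opZ c f t : backward_op (fun s => c * f s) t = c * backward_op f t.
Proof. by rewrite /backward_op -mulr_sumr mulrA. Qed.

Lemma iter_backward_ext n k f g t : t \in level (k + n) -> {in level n, f =1 g} ->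
  iter k backward_op f t = iter k backward_op g t.
Proof.
elim: k t => [|k IH] t tn fg; first exact: fg.
by rewrite /=; apply: (backward_op_ext tn) => s sn; apply: IH.
Qed.

Lemma iter_backward_cst k c t : iter k backward_op (fun=> c) t = c.
Proof.
elim: k t => //= k IH t.
by rewrite (_ : iter k backward_op _ = fun=> c) ?backward_op_cst //; exact/funext.
Qed.

Lemma iter_backward_sum (I : Type) (r : seq I) (F : I -> remy_tree -> R) (c : I -> R) k t :
  iter k backward_op (fun s => \sum_(i <- r) c i * F i s) t = \sum_(i <- r) c i * iter k backward_op (F i) t.
Proof.
elim: k t => //= k IH t; rewrite (_ : iter k backward_op _ = fun t => \sum_(i <- r) c i * iter k backward_op (F i) t); last exact/funext.
rewrite {1}/backward_op exchange_big /= mulr_suml; apply: eq_bigr => i _.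
by rewrite -mulr_sumr mulrA.
Qed.

Lemma iter_adjoint n k f g : \sum_(s <- level n) level_prob n * f s * iter k forward_op g s =
  \sum_(t <- level (k + n)) level_prob (k + n) * iter k backward_op f t * g t.
Proof.
elim: k g => //= k IH g.
by rewrite -iterS iterSr IH adjoint.
Qed.

Lemma sum_level_delta n (F : remy_tree -> R) s : s \in level n ->
  \sum_(t <- level n) F t * (t == s)%:R = F s.
Proof.
move=> sn; rewrite (bigD1_seq s) ?level_uniq //= eqxx mulr1 big1 ?addr0 // => t /negPf ->.
by rewrite mulr0.
Qed.

(* The probability that deleting uniform leaves of [t] one by one leads to [s];
   meaningful only if [s] has at most as many leaves as [t]. *)
Definition density s t : R := iter (nleaves t - nleaves s) backward_op (fun u => (u == s)%:R) t.

(** Bayes' formula over [k] steps: [iter_adjoint] for the indicators of [s] and [t]. *)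
Lemma iter_forward_density n k s t : s \in level n -> t \in level (k + n) ->
  level_prob n * iter k forward_op (fun u => (u == t)%:R) s = level_prob (k + n) * density s t.
Proof.
move=> sn tn; have := iter_adjoint n k (fun u => (u == s)%:R) (fun u => (u == t)%:R).
rewrite (sum_level_delta (fun t' => level_prob (k + n) * iter k backward_op (fun u => (u == s)%:R) t') tn).
under eq_bigr => u _ do rewrite mulrAC.
rewrite (sum_level_delta (fun s' => level_prob n * iter k forward_op (fun u => (u == t)%:R) s') sn) => ->.
rewrite /density; move: sn tn; rewrite !mem_level => /eqP -> /eqP ->.
by have -> : ((k + n).+2 - n.+2 = k)%N by lia.
Qed.

(** Leaf deletions always end in [aleph], the only tree of its level. *)
Lemma density_aleph t : density aleph t = 1.
Proof.
rewrite /density (@iter_backward_ext 0 _ _ (fun=> 1)) ?iter_backward_cst //.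
  by rewrite mem_level nleaves_aleph; have := nleaves_ge2 t; lia.
by move=> s; rewrite inE => ->.
Qed.

(* Both averages run over the deletion of a second leaf of [t]; matching the
   terms with the same second leaf leaves only the pair that deletes both [i]
   and [j], on which they agree. *)
Lemma backward_op_osc n f (d : R) : (0 < n)%N ->
  (forall t, t \in level n -> forall i j, (i < nleaves t)%N -> (j < nleaves t)%N ->
     f (rem_leaf t i) - f (rem_leaf t j) <= d) ->
  forall t, t \in level n.+1 -> forall i j, (i < nleaves t)%N -> (j < nleaves t)%N ->
     backward_op f (rem_leaf t i) - backward_op f (rem_leaf t j) <= d * n.+1%:R / n.+2%:R.
Proof.
move=> n0 Hd t tn i j it jt.
have t3 : (3 < nleaves t)%N by move: tn; rewrite mem_level => /eqP ->.
have tn' : nleaves t = n.+3 by move: tn; rewrite mem_level => /eqP ->.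
have lvd k : (k < nleaves t)%N -> nleaves (rem_leaf t k) = n.+2.
  by move=> kt; rewrite nleaves_rem_leaf //; lia.
have inl k : (k < nleaves t)%N -> rem_leaf t k \in level n by move=> /lvd; rewrite mem_level => ->.
(* the leaves are those of [t], hence the renumbering of [q] *)
pose c k q := f (rem_leaf (rem_leaf t k) (unbump k q)).
have csym k q : (k < nleaves t)%N -> (q < nleaves t)%N -> k != q -> c k q = c q k.
  move=> kt qt kq; rewrite /c /unbump.
  wlog kq' : k q kt qt kq / (k < q)%N.
    move=> W; have [kq1|qk] : (k < q)%N \/ (q < k)%N by lia.
      exact: W.
    by symmetry; apply: W; rewrite 1?eq_sym.
  have -> : (k < q)%N = true by [].
  have -> : (q < k)%N = false by lia.
  rewrite subn0 subn1; case: q kq' qt {kq} => // q kq' qt /=.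
  by rewrite rem_leaf_comm.
have sumc k : (k < nleaves t)%N -> backward_op f (rem_leaf t k) = (\sum_(q < n.+3 | q != k :> nat) c k q) / n.+2%:R.
  move=> kt; rewrite /backward_op lvd //; congr (_ / _).
  have kt' : (k < n.+3)%N by rewrite -tn'.
  rewrite [RHS](eq_bigl (fun q => q != Ordinal kt')) //.
  rewrite (reindex_onto (lift (Ordinal kt')) (fun q => odflt ord0 (unlift (Ordinal kt') q))) /=; last first.
    by move=> q; case: unliftP => [q' ->|-> /eqP].
  apply: eq_big => [q|q _]; last by rewrite /c bumpK.
  by rewrite liftK eqxx andbT -val_eqE /= eq_sym neq_bump.
have [->|ij] := eqVneq i j.
  rewrite subrr divr_ge0 // mulr_ge0 //.
  by have := Hd _ (inl _ it) 0 0; rewrite subrr; apply; rewrite lvd.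
have it' : (i < n.+3)%N by rewrite -tn'.
have jt' : (j < n.+3)%N by rewrite -tn'.
rewrite !sumc // -mulrBl ler_pM2r ?invr_gt0 ?ltr0n //.
rewrite (bigD1 (Ordinal jt')) /=; last by rewrite eq_sym.
rewrite [X in _ - X](bigD1 (Ordinal it')) /=; last by [].
rewrite (csym i j it jt ij) opprD addrACA subrr add0r.
rewrite [X in _ - X](eq_bigl (fun q : 'I_n.+3 => (q != i :> nat) && (q != Ordinal jt'))); last first.
  by move=> q; rewrite -!val_eqE /= andbC.
rewrite -sumrB.
(* Two of the [n.+3] leaves of [t] are excluded; the common denominator [n.+2], the number of leaves
   after one deletion, has been cancelled. *)
have -> : d * n.+1%:R = \sum_(q < n.+3 | (q != i :> nat) && (q != Ordinal jt')) d.
  rewrite sumr_const mulr_natr; congr (_ *+ _).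
  have := cardC [set Ordinal it'; Ordinal jt']%SET.
  rewrite cards2 card_ord -val_eqE /= ij => -[E].
  by rewrite -[LHS]E; apply: eq_card => q; rewrite !inE -!val_eqE /= negb_or.
apply: ler_sum => q /andP[qi]; rewrite -val_eqE /= => qj.
(* With [q] deleted first, both values are those of [f] on trees obtained from [rem_leaf t q] by one
   deletion, and [Hd] applies. *)
rewrite csym // 1?eq_sym //; last by rewrite tn'.
rewrite (csym j) // 1?eq_sym //; last by rewrite tn'.
apply: Hd; first by apply: inl; rewrite tn'.
all: by rewrite lvd ?tn' // /unbump; move: (ltn_ord q) qi qj => + /eqP + /eqP; lia.
Qed.
End Operators.

(** * Variance of leaf densities *)

Section Variance.
Context (R : realType).
Implicit Types (f g h : remy_tree -> R) (s t : remy_tree).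

Lemma backward_op_between g t (a b : R) :
  (forall i, (i < nleaves t)%N -> a <= g (rem_leaf t i) <= b) -> a <= backward_op g t <= b.
Proof.
move=> H; have N0 : 0 < (nleaves t)%:R :> R by rewrite ltr0n; have := nleaves_ge2 t; lia.
rewrite /backward_op ler_pdivlMr // ler_pdivrMr // !mulr_natr -[X in a *+ X](card_ord (nleaves t)).
rewrite -[X in b *+ X](card_ord (nleaves t)) -!sumr_const.
by apply/andP; split; apply: ler_sum => i _; have /andP[] := H i (ltn_ord i).
Qed.

(** Each value of [g] after a deletion is within [d] of their mean, so the variance is at most
    [d ^+ 2]. *)
Lemma backward_op_sqr_le g (d : R) t :
  (forall i j, (i < nleaves t)%N -> (j < nleaves t)%N -> g (rem_leaf t i) - g (rem_leaf t j) <= d) ->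
  backward_op (fun s => g s ^+ 2) t <= backward_op g t ^+ 2 + d ^+ 2.
Proof.
move=> H; set c := backward_op g t.
have E : backward_op (fun s => (g s - c) ^+ 2) t = backward_op (fun s => g s ^+ 2) t - c ^+ 2.
  have -> : (fun s => (g s - c) ^+ 2) = (fun s => g s ^+ 2 + ((- 2 * c) * g s + c ^+ 2)).
    by apply/funext => s; ring.
  by rewrite !backward_opD backward_opZ backward_op_cst -/c; ring.
rewrite -lerBlDl -E.
suff /andP[] : 0 <= backward_op (fun s => (g s - c) ^+ 2) t <= d ^+ 2 by [].
apply: backward_op_between => i it; rewrite sqr_ge0 /=.
have dev : g (rem_leaf t i) - d <= c <= g (rem_leaf t i) + d.
  by apply: backward_op_between => j jt; have := H i j it jt; have := H j i jt it; lra.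
by nra.
Qed.

Section Oscillation.
Variables (m : nat) (f : remy_tree -> R).
Hypothesis f01 : forall s, 0 <= f s <= 1.

(** The factors of [backward_op_osc] telescope, starting from oscillation 1 at level [m], whose
    trees have [m.+2] leaves. *)
Lemma iter_backward_osc k t : t \in level (k + m).+1 -> forall i j, (i < nleaves t)%N -> (j < nleaves t)%N ->
  iter k (@backward_op R) f (rem_leaf t i) - iter k (@backward_op R) f (rem_leaf t j) <= m.+2%:R / (k + m).+2%:R.
Proof.
elim: k t => [|k IH] t tk i j it jt.
  by rewrite divff ?pnatr_eq0 //=; have := f01 (rem_leaf t i); have := f01 (rem_leaf t j); lra.
have := @backward_op_osc R (k + m).+1 (iter k (@backward_op R) f) _ isT IH t tk i j it jt.
by rewrite mulfVK ?pnatr_eq0.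
Qed.

(** The deletion leading to level [n] adds at most [m.+2 ^ 2 / n.+2 ^ 2] to the conditional
    variance, and 1/(n+2)^2 is at most the telescoping difference 1/(n+1) - 1/(n+2). *)
Lemma iter_backward_sqr_le k l t : t \in level (l + (k + m)) ->
  iter l (@backward_op R) (fun s => iter k (@backward_op R) f s ^+ 2) t <=
  iter (l + k) (@backward_op R) f t ^+ 2 +
  m.+2%:R ^+ 2 * ((k + m).+1%:R^-1 - (l + (k + m)).+1%:R^-1).
Proof.
elim: l t => [|l IH] t tl; first by rewrite /= subrr mulr0 addr0.
set n := (l + (k + m))%N in IH tl *.
have -> : (l.+1 + (k + m))%N = n.+1 by [].
rewrite iterS; apply: (le_trans (backward_op_le tl IH)).
rewrite backward_opD backward_op_cst.
have osc i j : (i < nleaves t)%N -> (j < nleaves t)%N ->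
    iter (l + k) (@backward_op R) f (rem_leaf t i) - iter (l + k) (@backward_op R) f (rem_leaf t j) <= m.+2%:R / n.+2%:R.
  have := @iter_backward_osc (l + k) t; rewrite -addnA => /(_ tl); exact.
apply: (le_trans (lerD (backward_op_sqr_le osc) (lexx _))).
rewrite -/(iter (l + k).+1 (@backward_op R) f t) -addrA lerD2l.
rewrite expr_div_n -mulrDr; apply: ler_wpM2l; first exact: sqr_ge0.
have N1 : 0 < n.+1%:R :> R by rewrite ltr0n.
have E : n.+2%:R = n.+1%:R + 1 :> R by rewrite natr1.
have -> : (n.+1.+1%:R ^+ 2)^-1 = n.+2%:R^-1 ^+ 2 :> R by rewrite exprVn.
have key : n.+2%:R^-1 ^+ 2 <= n.+1%:R^-1 - n.+2%:R^-1 :> R; last first.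
  by move: key; move: (n.+2%:R^-1) (n.+1%:R^-1) ((k + m).+1%:R^-1) => x y z; lra.
have -> : n.+1%:R^-1 - n.+2%:R^-1 = n.+1%:R^-1 * n.+2%:R^-1 :> R.
  rewrite E; move: N1; move: (n.+1%:R) => x x0.
  by field; apply/andP; split; apply: lt0r_neq0; lra.
by rewrite expr2 ler_pM2r ?invr_gt0 ?ltr0n // lef_pV2 ?posrE ?ltr0n // ler_nat.
Qed.
End Oscillation.
End Variance.

(** * Harmonic functions *)

Lemma cvg_near_unique (R : realType) (u v : nat -> R) (a b : R) :
  u k @[k --> \oo] --> a -> v k @[k --> \oo] --> b ->
  (\forall k \near \oo, u k = v k) -> a = b.
Proof.
move=> ua vb uv; have va : v k @[k --> \oo] --> a.
  by apply: cvg_trans ua; apply: near_eq_cvg; exact: uv.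
by rewrite -(cvg_lim (@Rhausdorff R) va) -(cvg_lim (@Rhausdorff R) vb).
Qed.

Section Harmonic.
Context (R : realType).
Implicit Types (f g h y a b : remy_tree -> R) (s t : remy_tree).

(* For a normalized harmonic [y], the expectation of [f (X n)] under the
   h-transform of the chain by [y]. *)
Definition expect y n f : R := \sum_(s <- level n) level_prob R n * y s * f s.

Lemma expect_ext y n f g : {in level n, f =1 g} -> expect y n f = expect y n g.
Proof. by move=> fg; apply: eq_big_seq => s sn; rewrite fg. Qed.

Lemma expectD y n f g : expect y n (fun s => f s + g s) = expect y n f + expect y n g.
Proof. by rewrite /expect -big_split; apply: eq_bigr => s _; rewrite mulrDr. Qed.

Lemma expectZ y n c f : expect y n (fun s => c * f s) = c * expect y n f.
Proof. by rewrite /expect mulr_sumr; apply: eq_bigr => s _; rewrite mulrCA. Qed.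

Lemma expect_cst y n c : expect y n (fun=> c) = c * expect y n (fun=> 1).
Proof. by rewrite -expectZ; apply: expect_ext => s _; rewrite mulr1. Qed.

Lemma expect_delta y n s : s \in level n -> expect y n (fun u => (u == s)%:R) = level_prob R n * y s.
Proof. by move=> sn; rewrite /expect (sum_level_delta (fun s => level_prob R n * y s)). Qed.

Lemma expect_le y n f g : (forall s, 0 <= y s) -> {in level n, forall s, f s <= g s} ->
  expect y n f <= expect y n g.
Proof.
move=> y0 fg; rewrite /expect big_seq [X in _ <= X]big_seq; apply: ler_sum => s sn.
by rewrite ler_wpM2l ?fg // mulr_ge0 // ltW // level_prob_gt0.
Qed.

Section Normalized.
Variable y : remy_tree -> R.
Hypothesis Hy : normalized_harmonic R y.

(** Harmonicity moved across [adjoint]: bridges share the backward transitions of the chain. *)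
Lemma expect_backward n f : expect y n.+1 (backward_op f) = expect y n f.
Proof.
have [_ /harmonicE Uy _] := Hy.
rewrite /expect; under eq_bigr do rewrite mulrAC.
by rewrite -adjoint; apply: eq_bigr => s _; rewrite Uy mulrAC.
Qed.

Lemma expect_iter_backward n k f : expect y (k + n) (iter k (@backward_op R) f) = expect y n f.
Proof. by elim: k => //= k <-; rewrite expect_backward. Qed.

Lemma expect1 n : expect y n (fun=> 1) = 1.
Proof.
have [_ _ y1] := Hy.
have := expect_iter_backward 0 n (fun=> 1); rewrite addn0.
rewrite (@expect_ext _ _ _ (fun=> 1)) => [->|s _]; last by rewrite iter_backward_cst.
by rewrite /expect big_seq1 y1 !mulr1.
Qed.

Lemma expect_jensen n f : expect y n f ^+ 2 <= expect y n (fun s => f s ^+ 2).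
Proof.
have [y0 _ _] := Hy; set e := expect y n f.
have : expect y n (fun=> 0) <= expect y n (fun s => (f s - e) ^+ 2).
  by apply: expect_le => // s _; apply: sqr_ge0.
rewrite expect_cst mul0r (@expect_ext _ _ _ (fun s => f s ^+ 2 + (- 2 * e * f s + e ^+ 2))); last by move=> s _; ring.
by rewrite !expectD expectZ (expect_cst _ _ (e ^+ 2)) expect1 -/e; lra.
Qed.

Lemma expect_variance n f c : c = expect y n f ->
  expect y n (fun s => (f s - c) ^+ 2) = expect y n (fun s => f s ^+ 2) - c ^+ 2.
Proof.
move=> ->; set e := expect y n f.
rewrite (@expect_ext _ _ _ (fun s => f s ^+ 2 + (- 2 * e * f s + e ^+ 2))); last by move=> s _; ring.
by rewrite !expectD expectZ (expect_cst _ _ (e ^+ 2)) expect1 -/e; ring.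
Qed.
End Normalized.

(** For normalized harmonic [y] the left side is a variance, because averaging over deletions
    preserves the mean [expect y m f]. *)
Definition concentrated y := forall m f k, (forall s, 0 <= f s <= 1) ->
  expect y (k + m) (fun s => (iter k (@backward_op R) f s - expect y m f) ^+ 2) <=
  m.+2%:R ^+ 2 / (k + m).+1%:R.

Lemma le_inv_eq0 (x C : R) : (forall k, x <= C / k.+1%:R) -> x <= 0.
Proof.
move=> H; rewrite leNgt; apply/negP => x0.
have [N HN] : exists N, C / x < N.+1%:R.
  exists (Num.trunc (`|C / x|)); apply: le_lt_trans (ler_norm _) _.
  exact: truncnS_gt.
have := H N; rewrite ler_pdivlMr ?ltr0n // leNgt => /negP; apply.
by rewrite mulrC -ltr_pdivrMr.
Qed.

Lemma concentrated_extreme y a b u : normalized_harmonic R y -> concentrated y ->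
  normalized_harmonic R a -> normalized_harmonic R b -> 0 < u < 1 ->
  y = (fun s => u * a s + (1 - u) * b s) -> a = y.
Proof.
move=> Hy conc Ha Hb /andP[u0 u1] yE; apply/funext => s.
have [a0 _ _] := Ha; have [b0 _ _] := Hb; have [y0 _ _] := Hy.
(* The mean of the indicator of [s] at level [m] is the value at [s] times [level_prob R m], under
   [a] as under [y]. *)
pose m := (nleaves s - 2)%N; pose f := fun v => (v == s)%:R : R.
have f01 v : 0 <= f v <= 1 by rewrite /f; case: (_ == _) => /=; lra.
have sm : s \in level m by exact: mem_level_nleaves.
apply: (mulfI (level_prob_neq0 R m)); rewrite -!expect_delta -/f //.
apply/eqP; rewrite -subr_eq0 -sqrf_eq0; apply/eqP/le_anti; rewrite sqr_ge0 andbT.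
apply: (@le_inv_eq0 _ (u^-1 * m.+2%:R ^+ 2)) => k.
set c := expect y m f.
have E : expect a (k + m) (fun s => iter k (@backward_op R) f s - c) = expect a m f - c.
  by rewrite expectD (expect_cst _ _ (- c)) (expect1 Ha) mulr1 (expect_iter_backward Ha).
rewrite -E; apply: (le_trans (expect_jensen Ha _ _)).
rewrite -mulrA ler_pdivlMl //.
apply: (@le_trans _ _ (m.+2%:R ^+ 2 / (k + m).+1%:R)); last first.
  by rewrite ler_wpM2l ?sqr_ge0 // lef_pV2 ?posrE ?ltr0n // ler_nat; lia.
apply: le_trans (conc m f k f01).
(* The domination of laws: [u * a v] is at most [y v] for each [v]. *)
rewrite /expect mulr_sumr; apply: ler_sum => v _.
rewrite -/(expect y m f) -/c mulrA ler_wpM2r ?sqr_ge0 // mulrCA ler_wpM2l ?(ltW (level_prob_gt0 _ _)) //.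
by rewrite yE lerDl mulr_ge0 // subr_ge0 ltW.
Qed.

(** A closed form of the Martin kernel, see [martin_kernelE]; a tree with fewer leaves than [s] is
    never hit from [s], whence the value 0. *)
Definition density_ratio s t : R := if (nleaves s <= nleaves t)%N then density R s t / level_prob R (nleaves s - 2) else 0.

(** With these weights [expect] describes the chain conditioned to pass through [t], so it is
    computed by deleting leaves of [t]. *)
Lemma expect_density_ratio n f t : (n.+2 <= nleaves t)%N -> expect (density_ratio^~ t) n f = iter (nleaves t - n.+2) (@backward_op R) f t.
Proof.
move=> nt.
have tn : t \in level ((nleaves t - n.+2) + n) by rewrite mem_level; lia.
rewrite [RHS](@iter_backward_ext _ n _ _ (fun s => \sum_(u <- level n) f u * (s == u)%:R)) //; last first.
  by move=> s sn; under eq_bigr do rewrite eq_sym; rewrite (sum_level_delta f).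
rewrite (iter_backward_sum _ (fun u s => (s == u)%:R)).
apply: eq_big_seq => s; rewrite mem_level => /eqP sn.
by rewrite /density_ratio sn nt subSS subSS subn0 mulrCA divff ?level_prob_neq0 // mulr1 mulrC /density sn.
Qed.

Lemma density_ratio_ge0 s t : 0 <= density_ratio s t.
Proof.
rewrite /density_ratio; case: ifP => // st; rewrite divr_ge0 ?(ltW (level_prob_gt0 _ _)) // /density.
rewrite -[X in X <= _](iter_backward_cst (nleaves t - nleaves s) 0 t).
have tn : t \in level ((nleaves t - nleaves s) + (nleaves s - 2)).
  by rewrite mem_level; have := nleaves_ge2 s; lia.
clear st; move: (nleaves t - nleaves s)%N tn => k; elim: k t => [|k IH] t tn /=; first by rewrite ler0n.
by apply: (backward_op_le tn).
Qed.

Section Limit.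
Variables (T : nat -> remy_tree) (y : remy_tree -> R).
Hypothesis lvT : forall k, (k <= nleaves (T k))%N.
Hypothesis Ty : forall s, density_ratio s (T k) @[k --> \oo] --> y s.

Lemma expect_lim n f : expect (density_ratio^~ (T k)) n f @[k --> \oo] --> expect y n f.
Proof.
rewrite /expect; elim: (level n) => [|s l IH].
  by under eq_fun do rewrite big_nil; rewrite big_nil; exact: cvg_cst.
under eq_fun do rewrite big_cons; rewrite big_cons.
apply: cvgD => //; apply: cvgMl; apply: cvgMr; exact: Ty.
Qed.

(** Before the limit the identity holds at the levels up to that of [T k], hence, for fixed [n], for
    all large [k]. *)
Lemma expect_lim_backward n f : expect y n.+1 (backward_op f) = expect y n f.
Proof.
apply: cvg_near_unique (@expect_lim n.+1 (backward_op f)) (@expect_lim n f) _; near=> k.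
have kn : (n.+3 <= nleaves (T k))%N.
  by apply: leq_trans (lvT k); near: k; exact: nbhs_infty_ge.
rewrite !expect_density_ratio ?(ltnW kn) //.
have -> : (nleaves (T k) - n.+2 = (nleaves (T k) - n.+3).+1)%N by lia.
by rewrite iterSr.
Unshelve. all: by end_near. Qed.

(** Harmonicity at [s] is [expect_lim_backward] for the indicator of [s], read through [adjoint]. *)
Lemma lim_normalized : normalized_harmonic R y.
Proof.
split=> [s||].
- apply: (ler_cvg_to (f := fun=> 0) (cvg_cst 0) (@Ty s)).
  by near=> k; exact: density_ratio_ge0.
- apply/harmonicE => s; have sn := mem_level_nleaves s; set n := (nleaves s - 2)%N in sn.
  have := expect_lim_backward n (fun u => (u == s)%:R); rewrite expect_delta // => E.
  apply: (mulfI (level_prob_neq0 R n)); rewrite -E /expect.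
  under eq_bigr do rewrite mulrAC.
  rewrite -adjoint; under eq_bigr do rewrite mulrAC.
  by rewrite (sum_level_delta (fun s => level_prob R n * forward_op y s)).
- apply: (cvg_near_unique (v := fun=> 1) (@Ty aleph) (cvg_cst _)); near=> k; rewrite /density_ratio density_aleph nleaves_aleph nleaves_ge2 subnn.
  by rewrite -[level_prob _ _]/1 divr1.
Unshelve. all: by end_near. Qed.

(** Without its negative term, the bound of [iter_backward_sqr_le] does not depend on the size of
    [T j] and passes to the limit in [j]. *)
Lemma lim_concentrated : concentrated y.
Proof.
move=> m f k f01; have Hy := lim_normalized.
(* The variance is split into a second moment and a squared mean, each of which converges along
   [T]. *)
rewrite (expect_variance Hy); last by rewrite (expect_iter_backward Hy).
rewrite lerBlDl.
have c1 := @expect_lim (k + m) (fun s => iter k (@backward_op R) f s ^+ 2).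
have c2 : expect (density_ratio^~ (T j)) m f ^+ 2 + m.+2%:R ^+ 2 / (k + m).+1%:R @[j --> \oo] -->
    expect y m f ^+ 2 + m.+2%:R ^+ 2 / (k + m).+1%:R.
  apply: cvgD; last exact: cvg_cst.
  by rewrite expr2; under eq_fun do rewrite expr2; apply: cvgM; exact: expect_lim.
apply: (ler_cvg_to c1 c2); near=> j.
have kn : ((k + m).+2 <= nleaves (T j))%N.
  by apply: leq_trans (lvT j); near: j; exact: nbhs_infty_ge.
rewrite !expect_density_ratio //; last by lia.
have tn : T j \in level ((nleaves (T j) - (k + m).+2) + (k + m)) by rewrite mem_level; lia.
apply: (le_trans (iter_backward_sqr_le f01 tn)).
have -> : (nleaves (T j) - (k + m).+2 + k = nleaves (T j) - m.+2)%N by lia.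
by rewrite lerD2l ler_wpM2l ?sqr_ge0 // gerBl invr_ge0.
Unshelve. all: by end_near. Qed.
End Limit.
End Harmonic.

(** * Probabilities on paths *)

Section Decomposition.
Context (R : realType) (d : measure_display) (Omega : measurableType d).

(** Countable additivity over the values of [Z], enumerated by [pickle]. The factor [c] serves
    transition formulas, the two measures the comparison of total masses. *)
Lemma measure_split (mu nu : {measure set Omega -> \bar R}) (Z : Omega -> remy_tree)
    (A A' : set Omega) (c : R) :
  0 <= c -> measurable_fun setT Z -> measurable A -> measurable A' ->
  (forall t, mu (A `&` [set o | Z o = t]) = (c%:E * nu (A' `&` [set o | Z o = t]))%E) ->
  mu A = (c%:E * nu A')%E.
Proof.
move=> c0 mZ mA mA' H.
pose F (B : set Omega) n := B `&` [set o | pickle (Z o) = n].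
have mF B n : measurable B -> measurable (F B n).
  by move=> mB; apply: measurableI => //; have := mZ measurableT [set t | pickle t = n] I; rewrite setTI.
have FE B : B = \bigcup_n F B n.
  apply/seteqP; split=> o; first by exists (pickle (Z o)).
  by case=> n _ [].
have tF B : trivIset setT (F B).
  by move=> i j _ _ [x [ [_ /= <-] [_ /= <-]]].
rewrite {1}(FE A) {1}(FE A') !measure_semi_bigcup; last 6 first.
- by move=> n; apply: mF.
- exact: tF.
- by rewrite -FE.
- by move=> n; apply: mF.
- exact: tF.
- by rewrite -FE.
rewrite -nneseriesZl ?lee_fin //.
apply: eq_eseriesr => n _.
have [[t tn]|nt] := pselect (exists t : remy_tree, pickle t = n).
  have E B : F B n = B `&` [set o | Z o = t].
    congr (_ `&` _); apply/seteqP; split=> o /=; last by move=> ->.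
    by rewrite -tn => /(pcan_inj pickleK).
  by rewrite !E H.
have E B : F B n = set0 by apply/seteqP; split=> [x [_ /= h]|//]; apply: nt; exists (Z x).
by rewrite !E !measure0 mule0.
Qed.
End Decomposition.

Section Prob.
Context (R : realType) (d : measure_display) (Omega : measurableType d).
Variable (P : probability Omega R).
Implicit Types A B : set Omega.

Definition pr A : R := fine (P A).

Lemma prE A : measurable A -> P A = (pr A)%:E.
Proof. by move=> mA; rewrite fineK // fin_num_measure. Qed.

Lemma pr_ge0 A : 0 <= pr A.
Proof. exact: fine_ge0. Qed.

Lemma prT : pr setT = 1.
Proof. by rewrite /pr probability_setT. Qed.

Lemma pr0 : pr set0 = 0.
Proof. by rewrite /pr measure0. Qed.

Lemma pr_le A B : measurable A -> measurable B -> A `<=` B -> pr A <= pr B.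
Proof. by move=> mA mB AB; rewrite -lee_fin -!prE // le_measure ?inE. Qed.

Lemma pr_le1 A : measurable A -> pr A <= 1.
Proof. by move=> mA; rewrite -prT; apply: pr_le. Qed.

Lemma pr_sub0 A B : measurable A -> measurable B -> A `<=` B -> pr B = 0 -> pr A = 0.
Proof. by move=> mA mB AB B0; apply/le_anti; rewrite pr_ge0 -B0 pr_le. Qed.

Lemma pr_eq0 A : measurable A -> (P A == 0%E) = (pr A == 0).
Proof. by move=> mA; rewrite prE. Qed.

Lemma prU A B : measurable A -> measurable B -> A `&` B = set0 ->
  pr (A `|` B) = pr A + pr B.
Proof.
move=> mA mB AB; apply: EFin_inj; rewrite EFinD -!prE //; last exact: measurableU.
by rewrite measureU.
Qed.

Lemma pr_setC A : measurable A -> pr (~` A) = 1 - pr A.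
Proof.
move=> mA; rewrite -prT -(setUv A) prU //; first by ring.
  exact: measurableC.
exact: setICr.
Qed.

Lemma pr_split (Z : Omega -> remy_tree) A A' (c : R) :
  0 <= c -> measurable_fun setT Z -> measurable A -> measurable A' ->
  (forall t, pr (A `&` [set o | Z o = t]) = c * pr (A' `&` [set o | Z o = t])) ->
  pr A = c * pr A'.
Proof.
move=> c0 mZ mA mA' H.
have E : P A = (c%:E * P A')%E.
  apply: (measure_split (mu := P) (nu := P) c0 mZ mA mA') => t.
  have mt : measurable [set o | Z o = t].
    by have := mZ measurableT [set t] I; rewrite setTI.
  have mAt : measurable (A `&` [set o | Z o = t]) by exact: measurableI.
  have mAt' : measurable (A' `&` [set o | Z o = t]) by exact: measurableI.
  by rewrite [LHS](prE mAt) [X in (_ * X)%E](prE mAt') H EFinM.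
by apply: EFin_inj; rewrite EFinM -!prE.
Qed.

Lemma pr_null (Z : Omega -> remy_tree) A : measurable_fun setT Z -> measurable A ->
  (forall t, pr (A `&` [set o | Z o = t]) = 0) -> pr A = 0.
Proof.
by move=> mZ mA H; rewrite (@pr_split Z A setT 0) ?mul0r // => t; rewrite mul0r.
Qed.

Lemma pr_sum (Z : Omega -> remy_tree) (L : seq remy_tree) A :
  measurable_fun setT Z -> measurable A -> uniq L ->
  (forall t, t \notin L -> pr [set o | Z o = t] = 0) ->
  pr A = \sum_(t <- L) pr (A `&` [set o | Z o = t]).
Proof.
move=> mZ mA uL HL.
have mS (B : set remy_tree) : measurable [set o | B (Z o)] by have := mZ measurableT B I; rewrite setTI.
have E : A = (A `&` [set o | Z o \in L]) `|` (A `&` [set o | Z o \notin L]).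
  rewrite -setIUr; apply/seteqP; split=> o; last by case.
  by move=> Ao; split=> //=; case: (Z o \in L); [left|right].
rewrite [in LHS]E prU; first last.
- by apply/seteqP; split=> // o [ [_ /= h] [_ /= h']]; rewrite h in h'.
- by apply: measurableI => //; exact: (mS (fun t => t \notin L)).
- by apply: measurableI => //; exact: (mS (fun t => t \in L)).
rewrite [X in _ + X](@pr_null Z) ?addr0 //; first last.
- move=> t; have [tL|tL] := boolP (t \in L).
    rewrite (_ : _ `&` _ = set0) ?pr0 //; apply/seteqP; split=> // o [ [_ /= h] /= ht].
    by rewrite ht tL in h.
  apply: (@pr_sub0 _ [set o | Z o = t]); last exact: HL.
  + apply: measurableI; last exact: (mS [set t]).
    by apply: measurableI => //; exact: (mS (fun t => t \notin L)).
  + exact: (mS [set t]).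
  + by move=> o [].
- by apply: measurableI => //; exact: (mS (fun t => t \notin L)).
elim: L uL {HL E} => [|t L IH] /=.
  by rewrite big_nil (_ : _ `&` _ = set0) ?pr0 //; apply/seteqP; split=> // o [].
move=> /andP[tL uL]; rewrite big_cons -IH //.
rewrite -prU; first last.
- by apply/seteqP; split=> // o [ [_ /= h] [_ /= h']]; rewrite h (negPf tL) in h'.
- by apply: measurableI => //; exact: (mS (fun t => t \in L)).
- by apply: measurableI => //; exact: (mS [set t]).
congr (pr _); rewrite -setIUr; congr (_ `&` _); apply/seteqP; split=> o /=; rewrite inE.
  by move=> /orP[/eqP|]; [left|right].
by move=> [->|->]; rewrite ?eqxx ?orbT.
Qed.
End Prob.

(** * The sigma-algebra of paths and uniqueness of measures on it *)

Section PathSpace.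
Context (R : realType).

Lemma measurable_coord n : measurable_fun setT (coord_process n).
Proof.
move=> _ B _; rewrite setTI.
have -> : coord_process n @^-1` B = \bigcup_k
   (if unpickle k is Some t then if t \in B then [set w : path_space | w n = t] else set0 else set0).
  apply/seteqP; split=> w /=.
    move=> Bw; exists (pickle (w n)) => //=; rewrite pickleK.
    by move: Bw; rewrite /coord_process => Bw; rewrite mem_set.
  by move=> [k _]; case: (unpickle k) => [t|//]; case: ifPn => // /set_mem Bt /= wt; rewrite /coord_process wt.
apply: bigcupT_measurable => k; case: (unpickle k) => [t|]; last exact: measurable0.
case: ifPn => _; last exact: measurable0.
by apply: sub_sigma_algebra; exists n, t.
Qed.

Lemma measurable_past d (Omega : measurableType d) (X : nat -> Omega -> remy_tree) n w :
  (forall n, measurable_fun setT (X n)) -> measurable (past X n w).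
Proof.
move=> mX; have -> : past X n w = \bigcap_(i in [set i | (i <= n)%N]) [set o | X i o = w i].
  by apply/seteqP; split.
apply: bigcap_measurable; first by exists 0%N.
by move=> i _; have := mX i measurableT [set w i] I; rewrite setTI.
Qed.

(** A generating pi-system: two pasts are disjoint or meet in a past, whence [set0]; [setT] serves
    as exhausting sequence. *)
Definition pasts : set (set path_space) :=
  [set A | A = setT \/ A = set0 \/ exists n w, A = past coord_process n w].

Lemma pasts_measurable : pasts `<=` measurable.
Proof.
move=> A [->|[->|[n [w ->]]]]; [exact: measurableT|exact: measurable0|].
by apply: measurable_past => k; exact: measurable_coord.
Qed.

Lemma pasts_setI : setI_closed pasts.
Proof.
move=> A B [->|[->|[n [w ->]]]]; rewrite ?setTI ?set0I //; first by right; left.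
move=> [->|[->|[m [v ->]]]]; rewrite ?setIT ?setI0 //.
- by right; right; exists n, w.
- by right; left.
right; have [E|E] := pselect (past coord_process n w `&` past coord_process m v = set0); first by left.
right; exists (maxn n m); move: E => /eqP /set0P [u [nu mu]].
exists u; apply/seteqP; split=> [x [nx mx] i|x xu].
  rewrite leq_max => /orP[h|h]; first by rewrite nx // -nu.
  by rewrite mx // -mu.
by split=> i h; rewrite xu ?leq_max ?h ?orbT //; [exact: nu|exact: mu].
Qed.

(** A cylinder is a countable union of pasts, since a past is coded by the finite sequence of its
    states. *)
Lemma pasts_generate : @measurable _ path_space = <<s pasts >>.
Proof.
apply/seteqP; split; last first.
  by apply: smallest_sub; [exact: sigma_algebra_measurable|exact: pasts_measurable].
apply: smallest_sub; first exact: smallest_sigma_algebra.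
move=> A [n [t ->]].
pose F k := if unpickle k is Some l then
   if nth aleph l n == t then past coord_process n (nth aleph l) else set0 else set0.
have -> : [set w : nat -> remy_tree | w n = t] = \bigcup_k F k.
  apply/seteqP; split=> w /=.
    move=> wt; exists (pickle (mkseq w n.+1)) => //.
    rewrite /F pickleK nth_mkseq // wt eqxx => i ni.
    by rewrite nth_mkseq.
  by move=> [k _]; rewrite /F; case: (unpickle k) => [l|//]; case: eqP => // <- /(_ n (leqnn n)).
apply: (@bigcupT_measurable _ (g_sigma_algebraType pasts)) => k.
rewrite /F; case: (unpickle k) => [l|]; last exact: (@measurable0 _ (g_sigma_algebraType pasts)).
case: eqP => _; last exact: (@measurable0 _ (g_sigma_algebraType pasts)).
by apply: sub_sigma_algebra; right; right; exists n, (nth aleph l).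
Qed.

(** Finite measures instead of probabilities, so that laws restricted to an event are covered; the
    pasts at time 0 already give equal total masses. *)
Lemma path_measure_unique (m1 m2 : {measure set path_space -> \bar R}) :
  (m1 setT < +oo)%E -> (forall n w, m1 (past coord_process n w) = m2 (past coord_process n w)) ->
  forall A, measurable A -> m1 A = m2 A.
Proof.
move=> fin1 H.
have HT : m1 setT = m2 setT.
  rewrite (@measure_split _ _ _ m1 m2 (coord_process 0) setT setT 1) ?mul1e //.
    exact: measurable_coord.
  move=> t; rewrite !setTI mul1e.
  have -> : [set o | coord_process 0 o = t] = past coord_process 0 (fun=> t).
    apply/seteqP; split=> o /=; last by move=> /(_ 0%N isT).
    by move=> h i; rewrite leqn0 => /eqP ->.
  exact: H.
apply: (measure_unique pasts (fun=> setT)).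
- exact: pasts_generate.
- exact: pasts_setI.
- by move=> _; left.
- by apply/seteqP; split=> // x _; exists 0%N.
- by move=> A [->|[->|[n [w ->]]]] //; rewrite !measure0.
- by [].
Qed.
End PathSpace.

(** * Markov chains *)

(** A [past] with a free beginning, as needed for marginals and for events of the future. *)
Definition win (Omega : Type) (X : nat -> Omega -> remy_tree) (k n : nat)
    (w : nat -> remy_tree) : set Omega :=
  [set x | forall i, (k <= i <= n)%N -> X i x = w i].

Lemma past_win d (Omega : measurableType d) (X : nat -> Omega -> remy_tree) n w :
  past X n w = win X 0 n w.
Proof. by []. Qed.

Lemma win1 (Omega : Type) (X : nat -> Omega -> remy_tree) n w :
  win X n n w = [set x | X n x = w n].
Proof.
apply/seteqP; split=> x /=; first by apply; rewrite leqnn.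
by move=> h i /andP[ni iN]; have -> : i = n by lia.
Qed.

Lemma winS (Omega : Type) (X : nat -> Omega -> remy_tree) k n w : (k <= n.+1)%N ->
  win X k n.+1 w = win X k n w `&` [set x | X n.+1 x = w n.+1].
Proof.
move=> kn; apply/seteqP; split=> x /=.
  move=> h; split=> [i /andP[ki iN]|]; apply: h; lia.
move=> [h e] i /andP[ki]; rewrite leq_eqVlt => /orP[/eqP ->//|iN].
by apply: h; rewrite ki.
Qed.

Definition upd (w : nat -> remy_tree) k t : nat -> remy_tree :=
  fun i => if i == k then t else w i.

Lemma win_upd (Omega : Type) (X : nat -> Omega -> remy_tree) k n w t : (k <= n)%N ->
  win X k.+1 n w `&` [set x | X k x = t] = win X k n (upd w k t).
Proof.
move=> kn; apply/seteqP; split=> x /=.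
  move=> [h e] i /andP[ki iN]; rewrite /upd; case: eqP => [->//|ik].
  by apply: h; lia.
move=> h; split=> [i /andP[ki iN]|]; last by rewrite h ?leqnn // /upd eqxx.
rewrite h /upd ?iN ?(ltnW ki) //; case: eqP => // e; lia.
Qed.

Lemma measurable_win d (Omega : measurableType d) (X : nat -> Omega -> remy_tree) k n w :
  (forall n, measurable_fun setT (X n)) -> measurable (win X k n w).
Proof.
move=> mX; have -> : win X k n w = \bigcap_(i in [set i | (k <= i <= n)%N]) [set o | X i o = w i].
  by apply/seteqP; split.
have [kn|nk] := leqP k n; last first.
  rewrite (_ : [set i | _] = set0) ?bigcap_set0 //.
  by apply/seteqP; split=> // i /=; lia.
apply: bigcap_measurable; first by exists k; rewrite /= leqnn.
by move=> i _; have := mX i measurableT [set w i] I; rewrite setTI.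
Qed.

Lemma measurable_state d (Omega : measurableType d) (X : nat -> Omega -> remy_tree) n t :
  (forall n, measurable_fun setT (X n)) -> measurable [set x | X n x = t].
Proof. by move=> mX; have := mX n measurableT [set t] I; rewrite setTI. Qed.

Section Chain.
Context (R : realType) (d : measure_display) (Omega : measurableType d).
Variables (P : probability Omega R) (X : nat -> Omega -> remy_tree).
Variables (s0 : remy_tree) (Q : remy_tree -> remy_tree -> R).
Hypothesis MC : markov_chain P X s0 Q.
Hypothesis Q0 : forall s t, 0 <= Q s t.

Let mX n : measurable_fun setT (X n). Proof. by have [] := MC. Qed.

Lemma mc_past n w : pr P (win X 0 n.+1 w) = pr P (win X 0 n w) * Q (w n) (w n.+1).
Proof.
have mp := measurable_win 0 n w mX; have ms := measurable_state n.+1 (w n.+1) mX.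
have [p0|p0] := eqVneq (pr P (win X 0 n w)) 0.
  rewrite p0 mul0r; apply: (pr_sub0 _ mp) => //; first exact: measurable_win.
  by rewrite winS // => x [].
have [_ _ /(_ n w (w n.+1))] := MC.
rewrite past_win pr_eq0 // => /(_ p0) <-.
by rewrite /cond_pr setIC -winS // mulrC divfK.
Qed.

(** The Markov property conditions on the whole past; summing over the first state of a window frees
    the beginning one time after the other. *)
Lemma mc_win k n w : (k <= n)%N ->
  pr P (win X k n.+1 w) = pr P (win X k n w) * Q (w n) (w n.+1).
Proof.
elim: k w => [|k IH] w kn; first exact: mc_past.
rewrite mulrC; apply: (pr_split (Q0 _ _) (mX k) (measurable_win _ _ _ mX) (measurable_win _ _ _ mX)) => t.
rewrite !win_upd ?(ltnW kn) //; last by lia.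
rewrite IH ?(ltnW kn) // mulrC /upd.
have -> : (n == k) = false by lia.
by have -> : (n.+1 == k) = false by lia.
Qed.

Lemma mc_win_prod k j w : pr P (win X k (j + k) w) =
  pr P [set x | X k x = w k] * \prod_(i < j) Q (w (i + k)%N) (w (i + k).+1).
Proof.
elim: j => [|j IH]; first by rewrite big_ord0 mulr1 win1.
by rewrite addSn mc_win ?leq_addl // IH big_ord_recr /= mulrA.
Qed.

Lemma mc_pair n s t : pr P ([set x | X n x = s] `&` [set x | X n.+1 x = t]) =
  pr P [set x | X n x = s] * Q s t.
Proof.
pose w i := if i == n then s else t.
have wn : w n = s by rewrite /w eqxx.
have wn1 : w n.+1 = t by rewrite /w; case: eqP => //; lia.
by have := @mc_win n n w (leqnn n); rewrite winS // win1 wn wn1.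
Qed.

Lemma mc_init s : pr P [set x | X 0%N x = s] = (s == s0)%:R.
Proof.
have [_ h _] := MC; have E : pr P [set x | X 0%N x = s0] = 1 by rewrite /pr h.
have [->//|ne] := eqVneq s s0.
apply: (@pr_sub0 _ _ _ _ _ (~` [set x | X 0%N x = s0])).
- exact: measurable_state.
- by apply: measurableC; exact: measurable_state.
- by move=> x /= -> /eqP; rewrite (negPf ne).
- by rewrite pr_setC ?E ?subrr //; exact: measurable_state.
Qed.

Hypothesis Qlv : forall s t, Q s t != 0 -> nleaves t = (nleaves s).+1.

Lemma mc_level n t : nleaves t != (nleaves s0 + n)%N -> pr P [set x | X n x = t] = 0.
Proof.
elim: n t => [|n IH] t.
  by rewrite addn0 mc_init; case: (eqVneq t s0) => [->|]; rewrite ?eqxx.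
move=> ht; apply: (pr_null (mX n)); first exact: measurable_state.
move=> s; rewrite setIC mc_pair.
have [->|/Qlv st] := eqVneq (Q s t) 0; first by rewrite mulr0.
by rewrite IH ?mul0r //; apply: contraNneq ht => h; rewrite st h addnS.
Qed.

Lemma mc_sum n A : measurable A ->
  pr P A = \sum_(t <- level (nleaves s0 - 2 + n)) pr P (A `&` [set x | X n x = t]).
Proof.
move=> mA; apply: pr_sum => //; first exact: level_uniq.
move=> t; rewrite mem_level => h; apply: mc_level; apply: contraNneq h => ->.
by have := nleaves_ge2 s0; lia.
Qed.

Lemma mc_marginal n t : pr P [set x | X n.+1 x = t] =
  \sum_(s <- level (nleaves s0 - 2 + n)) pr P [set x | X n x = s] * Q s t.
Proof.
rewrite (mc_sum n); last exact: measurable_state.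
by apply: eq_bigr => s _; rewrite setIC mc_pair.
Qed.
End Chain.

Section Law.
Context (R : realType) (d : measure_display) (Omega : measurableType d).
Variables (P : probability Omega R) (X : nat -> Omega -> remy_tree).
Hypothesis mX : forall n, measurable_fun setT (X n).

Definition path_map (x : Omega) : path_space := fun n => X n x.

Lemma measurable_path_map : measurable_fun setT path_map.
Proof.
apply: (@measurability _ _ Omega path_space setT path_map cylinders) => //.
by move=> _ [_ [n [t ->]] <-]; rewrite setTI; exact: measurable_state.
Qed.

Definition path_mfun : {mfun Omega >-> path_space} :=
  HB.pack path_map (isMeasurableFun.Build _ _ _ _ path_map measurable_path_map).

Definition law_of : probability path_space R := distribution P path_mfun.

Lemma law_ofE A : law_of A = P [set x | A (fun n => X n x)].
Proof. by []. Qed.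

Lemma law_of_markov_chain s0 Q : markov_chain P X s0 Q -> markov_chain law_of coord_process s0 Q.
Proof.
move=> [_ h0 h]; split; [exact: measurable_coord|exact: h0|].
by move=> n w t; exact: (h n w t).
Qed.
End Law.

Lemma mc_law_unique (R : realType) d1 d2 (O1 : measurableType d1) (O2 : measurableType d2)
    (P1 : probability O1 R) (P2 : probability O2 R) X1 X2 s0 Q :
  (forall s t, 0 <= Q s t) -> markov_chain P1 X1 s0 Q -> markov_chain P2 X2 s0 Q ->
  forall A : set path_space, measurable A ->
    P1 [set x | A (fun n => X1 n x)] = P2 [set x | A (fun n => X2 n x)].
Proof.
move=> Q0 M1 M2 A mA.
have [mX1 _ _] := M1; have [mX2 _ _] := M2.
rewrite -(law_ofE P1 mX1) -(law_ofE P2 mX2).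
apply: path_measure_unique => //; first by apply: (@le_lt_trans _ _ 1%E); [exact: probability_le1|exact: ltry].
move=> n w; change (P1 (win X1 0 n w) = P2 (win X2 0 n w)).
have m1 := measurable_win 0 n w mX1; have m2 := measurable_win 0 n w mX2.
rewrite (prE P1 m1) (prE P2 m2).
by rewrite -[n]addn0 (mc_win_prod M1) // (mc_win_prod M2) // (mc_init M1) // (mc_init M2).
Qed.

(** * Existence of Markov chains *)

Section Existence.
Context (R : realType).

Definition unif : probability (measurableTypeR R) R := uniform_prob (@ltr01 R).

Lemma unif_itv (a b : R) : 0 <= a -> a <= b -> b <= 1 -> unif `[a, b[%classic = (b - a)%:E.
Proof.
move=> a0 ab b1.
have mE : measurable (`[a, b[%classic : set (measurableTypeR R)) by exact: measurable_itv.
rewrite [LHS]integral_uniform_pdf.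
have -> : `[a, b[%classic `&` `[0, 1]%classic = `[a, b[%classic :> set R.
  apply/setIidPl => x /=; rewrite !in_itv /= => /andP[ax xb].
  by rewrite (le_trans a0 ax) (ltW (lt_le_trans xb b1)).
rewrite (eq_integral (cst 1%E)); last first.
  move=> x; rewrite inE /= in_itv /= => /andP[ax xb]; rewrite /uniform_pdf.
  by rewrite (le_trans a0 ax) (ltW (lt_le_trans xb b1)) subr0 invr1.
rewrite integral_cst //= mul1e lebesgue_measure_itv /= lte_fin.
by move: ab; rewrite le_eqVlt => /orP[/eqP ->|->]; rewrite ?ltxx ?subrr ?EFinB.
Qed.

Variables (s0 : remy_tree) (Q : remy_tree -> remy_tree -> R).
(** [G] is closed under the transitions and contains [s0]. Rows of [Q] outside [G] may fail to be
    probability vectors, as those of an h-transform at the zeros of h. *)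
Variables (succ : remy_tree -> seq remy_tree) (G : set remy_tree).
Hypothesis Q0 : forall s t, 0 <= Q s t.
Hypothesis Gs0 : G s0.
Hypothesis succ_uniq : forall s, uniq (succ s).
Hypothesis Qsucc : forall s t, t \notin succ s -> Q s t = 0.
Hypothesis Gsum : forall s, G s -> \sum_(t <- succ s) Q s t = 1.
Hypothesis Gsucc : forall s t, G s -> 0 < Q s t -> G t.

(* Splits [0, sum of the q x) into consecutive intervals of lengths [q x], and
   returns the label of the interval of [v] with the rescaled position of [v]
   in it. *)
Fixpoint pick (q : remy_tree -> R) (l : seq remy_tree) (v : R) : remy_tree * R :=
  if l is t :: l' then
    if v < q t then (t, v / q t) else pick q l' (v - q t)
  else (aleph, 0).

(** The left end of the interval that [pick] assigns to [t]. *)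
Fixpoint cum (q : remy_tree -> R) (l : seq remy_tree) (t : remy_tree) : R :=
  if l is x :: l' then if x == t then 0 else q x + cum q l' t else 0.

Lemma cum_ge0 (q : remy_tree -> R) l t : (forall x, 0 <= q x) -> 0 <= cum q l t.
Proof. by move=> q0; elim: l => //= x l IH; case: eqP => // _; rewrite addr_ge0. Qed.

Lemma cum_le (q : remy_tree -> R) l t : (forall x, 0 <= q x) -> t \in l ->
  cum q l t + q t <= \sum_(x <- l) q x.
Proof.
move=> q0; elim: l => //= x l IH; rewrite inE big_cons eq_sym.
have [->|_] /= := eqVneq x t; last by move=> /IH; lra.
by rewrite add0r lerDl sumr_ge0.
Qed.

Lemma pick_mem (q : remy_tree -> R) l v : (forall x, 0 <= q x) -> v < \sum_(x <- l) q x ->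
  0 <= v -> (pick q l v).1 \in l.
Proof.
move=> q0; elim: l v => [|x l IH] v; first by rewrite big_nil; lra.
rewrite big_cons /= inE => h v0; case: ifPn => [_|]; first by rewrite eqxx.
by rewrite -leNgt => xv; rewrite IH ?orbT //; lra.
Qed.

Lemma pickP (q : remy_tree -> R) l v t : (forall x, 0 <= q x) -> uniq l -> t \in l ->
  v < \sum_(x <- l) q x -> 0 <= v ->
  ((pick q l v).1 == t) = (cum q l t <= v < cum q l t + q t).
Proof.
move=> q0; elim: l v => // x l IH v /= /andP[xl ul]; rewrite inE big_cons => tl h v0.
have [xt|nxt] := eqVneq x t.
  rewrite -xt v0 add0r /=; case: ifPn => [_|]; first by rewrite eqxx.
  rewrite -leNgt => xv; apply/eqP => e; move: xl; rewrite -{1}e pick_mem //; lra.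
have {}tl : t \in l by move: tl; rewrite eq_sym (negPf nxt).
have c0 := cum_ge0 l t q0.
case: ifPn => [vx|]; first by rewrite /= (negPf nxt); apply/esym/negP => /andP[]; lra.
rewrite -leNgt => xv; rewrite IH //; [|lra..].
by apply/andP/andP => -[]; lra.
Qed.

Lemma pick_pos (q : remy_tree -> R) l v : (forall x, 0 <= q x) -> uniq l ->
  v < \sum_(x <- l) q x -> 0 <= v ->
  (pick q l v).2 = (v - cum q l (pick q l v).1) / q (pick q l v).1.
Proof.
move=> q0; elim: l v => [|x l IH] v /=; first by rewrite big_nil; lra.
move=> /andP[xl ul]; rewrite big_cons => h v0.
case: ifPn => [vx|] /=; first by rewrite eqxx subr0.
rewrite -leNgt => xv; case: eqP => [e|_].
  by move: xl; rewrite {1}e pick_mem //; lra.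
by rewrite IH //; [congr (_ / _); ring|lra..].
Qed.

(** Keeps the walk defined for every real; only a null set of [unif] is moved. *)
Definition clamp (u : R) : R := if 0 <= u < 1 then u else 0.

(* The whole chain is driven by one uniform variable, whose rescaled position in
   the interval of the current path is again uniform. *)
Fixpoint walk (n : nat) (u : R) : remy_tree * R :=
  if n is n'.+1 then pick (Q (walk n' u).1) (succ (walk n' u).1) (walk n' u).2
  else (s0, clamp u).

Definition walk_state n u := (walk n u).1.

Definition path_weight (w : nat -> remy_tree) n : R :=
  (w 0%N == s0)%:R * \prod_(i < n) Q (w i) (w i.+1).

Lemma path_weightS w n : path_weight w n.+1 = path_weight w n * Q (w n) (w n.+1).
Proof. by rewrite /path_weight big_ord_recr /= mulrA. Qed.

Lemma path_weight_ge0 w n : 0 <= path_weight w n.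
Proof. by rewrite mulr_ge0 // prodr_ge0. Qed.

Lemma path_weight_G w n : 0 < path_weight w n -> G (w n).
Proof.
elim: n => [|n IH]; first by rewrite /path_weight big_ord0 mulr1; case: eqP => [->|]; rewrite ?ltxx.
rewrite path_weightS => h; have p0 := path_weight_ge0 w n.
have q0 : 0 < Q (w n) (w n.+1).
  by rewrite lt0r Q0 andbT; apply/eqP => e; move: h; rewrite e mulr0 ltxx.
apply: Gsucc q0; apply: IH; rewrite lt0r p0 andbT; apply/eqP => e.
by move: h; rewrite e mul0r ltxx.
Qed.

Lemma clamp01 u : 0 <= clamp u < 1.
Proof. by rewrite /clamp; case: ifP => // _; rewrite lexx ltr01. Qed.

(** The numbers that drive the walk along [w] fill an interval whose length is the weight of the
    path, and the second component of [walk] is the affine coordinate in it; so the next choice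
    again has the right proportions. *)
Lemma walk_itv w n : exists a : R, [/\ 0 <= a, a + path_weight w n <= 1,
  (forall u, win walk_state 0 n w u <-> a <= clamp u < a + path_weight w n) &
  (forall u, win walk_state 0 n w u -> (walk n u).2 = (clamp u - a) / path_weight w n)].
Proof.
elim: n => [|n [a [a0 a1 H1 H2]]].
  exists 0; rewrite /path_weight big_ord0 mulr1 !add0r; split=> //.
  - by case: (_ == _).
  - move=> u; rewrite win1 /=; have := clamp01 u; rewrite /walk_state /=.
    have [->|ne] := eqVneq (w 0%N) s0; first by split.
    by move=> h; split=> [e|]; [rewrite e eqxx in ne|move=> /andP[h1 h2]; move: (le_lt_trans h1 h2); rewrite ltxx].
  - move=> u; rewrite win1 /= /walk_state /= => <-.
    by rewrite eqxx subr0 divr1.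
rewrite path_weightS; set p := path_weight w n in a1 H1 H2 *.
have p0 : 0 <= p := path_weight_ge0 w n.
set q := Q (w n) (w n.+1).
(* A path of weight 0 has the empty interval, and so have its extensions. *)
have [pe|pn0] := eqVneq p 0.
  exists a; rewrite pe mul0r addr0; split=> //; first by lra.
  - move=> u; split; last by move=> /andP[h1 h2]; move: (le_lt_trans h1 h2); rewrite ltxx.
    by rewrite winS // => -[/H1 /andP[h1 h2] _]; move: (le_lt_trans h1 h2); rewrite pe addr0 ltxx.
  - by move=> u; rewrite winS // => -[/H1 /andP[h1 h2] _]; move: (le_lt_trans h1 h2); rewrite pe addr0 ltxx.
have pp : 0 < p by rewrite lt0r pn0.
have Gw : G (w n) := path_weight_G pp.
have sum1 := Gsum Gw.
have q0 : 0 <= q by exact: Q0.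
have pos u : win walk_state 0 n w u -> 0 <= (walk n u).2 < \sum_(t <- succ (w n)) Q (w n) t.
  move=> wu; rewrite (H2 u wu) sum1; move/H1: wu => /andP[h1 h2].
  by rewrite divr_ge0 ?subr_ge0 //= ltr_pdivrMr // mul1r; lra.
have step u : win walk_state 0 n w u ->
    walk n.+1 u = pick (Q (w n)) (succ (w n)) (walk n u).2.
  by move=> /(_ n); rewrite leqnn => /(_ isT) e /=; rewrite -[(walk n u).1]/(walk_state n u) e.
have [tl|tl] := boolP (w n.+1 \in succ (w n)); last first.
  have no u : ~ win walk_state 0 n.+1 w u.
    rewrite winS // => -[wu] /=; rewrite /walk_state step // => e.
    by move: (pos u wu) tl => /andP[v0 v1]; rewrite -e pick_mem.
  exists a; rewrite /q (Qsucc tl) mulr0 addr0; split=> //; first by lra.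
    by move=> u; split=> [/no//|/andP[h1 h2]]; move: (le_lt_trans h1 h2); rewrite ltxx.
  by move=> u /no.
have c0 := cum_ge0 (succ (w n)) (w n.+1) (Q0 (w n)).
have c1 := cum_le (Q0 (w n)) tl; rewrite sum1 -/q in c1.
set c := cum _ _ _ in c0 c1.
have char u : win walk_state 0 n.+1 w u <->
    win walk_state 0 n w u /\ c <= (walk n u).2 < c + q.
  rewrite winS //; split=> -[wu] /=; rewrite /walk_state step // => h; split=> //;
    have /andP[v0 v1] := pos u wu.
    by rewrite -(pickP (Q0 (w n)) (succ_uniq _) tl v1 v0) h.
  by apply/eqP; rewrite pickP.
(* The interval of [w n.+1] inside that of the path, scaled by the length [p] of the latter. *)
exists (a + p * c); split.
- by rewrite addr_ge0 // mulr_ge0.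
- by apply: le_trans a1; rewrite -addrA -mulrDr lerD2l -[leRHS]mulr1 ler_wpM2l.
- move=> u; rewrite char -addrA -mulrDr; split.
    move=> [wu]; rewrite (H2 u wu) ler_pdivlMr // ltr_pdivrMr //.
    by rewrite ![_ * p]mulrC => /andP[h1 h2]; lra.
  move=> /andP[h1 h2].
  have wu : win walk_state 0 n w u.
    apply/H1; apply/andP; split.
      by apply: le_trans h1; rewrite lerDl mulr_ge0.
    by apply: lt_le_trans h2 _; rewrite lerD2l -[leRHS]mulr1 ler_wpM2l.
  split=> //; rewrite (H2 u wu) ler_pdivlMr // ltr_pdivrMr //.
  by rewrite ![_ * p]mulrC; apply/andP; lra.
- move=> u wu; have [wu' _] := (char u).1 wu; have /andP[v0 v1] := pos u wu'.
  rewrite step // pick_pos //.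
  have -> : (pick (Q (w n)) (succ (w n)) (walk n u).2).1 = w n.+1.
    by rewrite -step //; apply: wu; rewrite leqnn.
  rewrite -/c -/q (H2 u wu') [in RHS](invfM p q) mulrA; congr (_ / _).
  by field.
Qed.

Lemma measurable_clamp_itv (a b : R) :
  measurable ([set u | a <= clamp u < b] : set (measurableTypeR R)).
Proof.
have -> : [set u | a <= clamp u < b] = (`[a, b[%classic `&` `[0, 1[%classic) `|`
   (if a <= 0 < b then ~` `[0, 1[%classic else set0) :> set R.
  apply/seteqP; split=> u /=; rewrite /clamp !in_itv /=.
    case: ifP => h hu; first by left.
    by right; rewrite hu /= in_itv /= h.
  move=> [[h ->]//|]; case: ifP => // h /=.
  by rewrite in_itv /= => /negP /negPf ->.
apply: measurableU; first by apply: measurableI; exact: measurable_itv.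
by case: ifP => _; [apply: measurableC; exact: measurable_itv|exact: measurable0].
Qed.

Lemma unif_clamp_itv (a b : R) : 0 <= a -> a <= b -> b <= 1 ->
  pr unif [set u | a <= clamp u < b] = b - a.
Proof.
move=> a0 ab b1.
have mI : measurable (`[0, 1[%classic : set (measurableTypeR R)) by exact: measurable_itv.
have mE : measurable (`[a, b[%classic : set (measurableTypeR R)) by exact: measurable_itv.
have I1 : pr unif `[0, 1[%classic = 1 by rewrite /pr unif_itv // subr0.
have mC := measurable_clamp_itv a b.
have Eab : `[a, b[%classic `&` `[0, 1[%classic = `[a, b[%classic :> set R.
  apply/setIidPl => x /=; rewrite !in_itv /= => /andP[ax xb].
  by rewrite (le_trans a0 ax) (lt_le_trans xb b1).
have -> : [set u | a <= clamp u < b] = `[a, b[%classic `|`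
    ([set u | a <= clamp u < b] `&` ~` `[0, 1[%classic) :> set R.
  apply/seteqP; split=> u /=; rewrite /clamp !in_itv /=.
    by case: ifP => h hu; [left|right; rewrite hu; split].
  move=> [/andP[ax xb]|[]//].
  by rewrite (le_trans a0 ax) (lt_le_trans xb b1) /= ax xb.
rewrite prU //; first last.
- apply/seteqP; split=> // u [] /=; rewrite !in_itv /= => /andP[ax xb] [_].
  by rewrite (le_trans a0 ax) (lt_le_trans xb b1).
- by apply: measurableI => //; exact: measurableC.
rewrite [X in _ + X](@pr_sub0 _ _ _ unif _ (~` `[0, 1[%classic)) ?addr0.
- by rewrite /pr unif_itv.
- by apply: measurableI => //; exact: measurableC.
- exact: measurableC.
- by move=> u [].
- by rewrite pr_setC // I1 subrr.
Qed.

Lemma measurable_walk_win n w : measurable (win walk_state 0 n w : set (measurableTypeR R)).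
Proof.
have [a [_ _ H _]] := walk_itv w n.
rewrite (_ : win _ _ _ _ = [set u | a <= clamp u < a + path_weight w n]).
  exact: measurable_clamp_itv.
by apply/seteqP; split=> u /H.
Qed.

Lemma pr_walk_win n w : pr unif (win walk_state 0 n w) = path_weight w n.
Proof.
have [a [a0 a1 H _]] := walk_itv w n; have p0 := path_weight_ge0 w n.
rewrite (_ : win _ _ _ _ = [set u | a <= clamp u < a + path_weight w n]).
  by rewrite unif_clamp_itv //; lra.
by apply/seteqP; split=> u /H.
Qed.

Lemma measurable_walk_state n :
  measurable_fun setT (walk_state n : measurableTypeR R -> remy_tree).
Proof.
move=> _ B _; rewrite setTI.
pose F k := if unpickle k is Some l then
   if nth aleph l n \in B then win walk_state 0 n (nth aleph l) else set0 else set0.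
have -> : walk_state n @^-1` B = \bigcup_k F k.
  apply/seteqP; split=> u /=.
    move=> Bu; exists (pickle (mkseq (walk_state^~ u) n.+1)) => //.
    rewrite /F pickleK nth_mkseq // mem_set // => i /andP[_ iN].
    by rewrite nth_mkseq.
  move=> [k _]; rewrite /F; case: (unpickle k) => [l|//]; case: ifPn => // /set_mem Bt /(_ n).
  by rewrite leqnn => /(_ isT) ->.
apply: bigcupT_measurable => k; rewrite /F; case: (unpickle k) => [l|]; last exact: measurable0.
by case: ifPn => _; [exact: measurable_walk_win|exact: measurable0].
Qed.

Lemma walk_markov_chain : markov_chain unif walk_state s0 Q.
Proof.
split; first exact: measurable_walk_state.
  have m0 : measurable [set u : measurableTypeR R | walk_state 0 u = s0].
    exact: (measurable_state 0 s0 measurable_walk_state).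
  rewrite (prE _ m0).
  have := pr_walk_win 0 (fun=> s0); rewrite win1 => ->.
  by rewrite /path_weight big_ord0 eqxx mulr1.
move=> n w t; rewrite past_win; have mw := measurable_walk_win n w.
rewrite pr_eq0 // => p0.
rewrite /cond_pr setIC.
have -> : win walk_state 0 n w `&` [set o | walk_state n.+1 o = t] =
  win walk_state 0 n.+1 (upd w n.+1 t).
  rewrite winS // /upd eqxx; congr (_ `&` _).
  by apply/seteqP; split=> u h i iN; rewrite h //; case: eqP => // e; lia.
rewrite -[fine _]/(pr unif _) -[fine (unif _)]/(pr unif _).
rewrite !pr_walk_win path_weightS in p0 *.
have -> : path_weight (upd w n.+1 t) n = path_weight w n.
  rewrite /path_weight /upd /=; congr (_ * _); apply: eq_bigr => i _.
  have := ltn_ord i; case: eqP => [|_]; first by lia.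
  by case: eqP => [|//]; lia.
rewrite /upd eqxx (_ : (n == n.+1) = false); last by lia.
by rewrite mulrAC divff // mul1r.
Qed.

(** The choice in [chain_law] has the required property as soon as one law has it; the law of the
    walk does. *)
Lemma chain_law_markov_chain : markov_chain (chain_law s0 Q) coord_process s0 Q.
Proof.
apply: (@xgetPex _ _ [set mu : probability path_space R | markov_chain mu coord_process s0 Q]).
exists (law_of unif measurable_walk_state); exact/law_of_markov_chain/walk_markov_chain.
Qed.
End Existence.

(** * The Martin kernel *)

Section Laws.
Context (R : realType).
Implicit Types (f g h y : remy_tree -> R) (s t : remy_tree).

Lemma forward_opE_undup f s : forward_op f s = \sum_(t <- undup (rmoves s)) remy_P R s t * f t.
Proof.
rewrite /forward_op (@sum_count _ _ _ (undup (rmoves s))) ?undup_uniq //.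
  by rewrite mulr_suml; apply: eq_bigr => t _; rewrite remy_PE mulrAC.
by move=> t; rewrite mem_undup.
Qed.

Lemma forward_op1 s : forward_op (fun=> 1 : R) s = 1.
Proof.
rewrite /forward_op big_const_seq count_predT iter_addr_0 size_map size_remy_moves.
by rewrite divff // nb_vertices_neq0.
Qed.

Lemma remy_law_chain s : markov_chain (remy_law R s) coord_process s (remy_P R).
Proof.
apply: (@chain_law_markov_chain _ _ _ (fun s => undup (rmoves s)) setT) => //.
- exact: remy_P_ge0.
- by move=> u; exact: undup_uniq.
- by move=> u t; rewrite mem_undup; exact: remy_P_eq0.
- by move=> u _; rewrite -[RHS](forward_op1 u) forward_opE_undup; apply: eq_bigr => t _; rewrite mulr1.
Qed.

Lemma htransform_ge0 y : (forall s, 0 <= y s) -> forall s t, 0 <= htransform y s t.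
Proof. by move=> y0 s t; rewrite /htransform !mulr_ge0 ?invr_ge0 ?remy_P_ge0. Qed.

Lemma htransform_nleaves y s t : htransform y s t != 0 -> nleaves t = (nleaves s).+1.
Proof.
by rewrite /htransform; have [->|/remy_P_nleaves ->] := eqVneq (remy_P R s t) 0; rewrite ?mulr0 ?mul0r ?eqxx.
Qed.

(** Here [G] is the set where [y] is positive: harmonicity makes its rows sum to 1, and the
    h-transform cannot enter a zero of [y]. *)
Lemma bridge_of_chain y : normalized_harmonic R y ->
  markov_chain (bridge_of y) coord_process aleph (htransform y).
Proof.
move=> [y0 /harmonicE Uy y1].
apply: (@chain_law_markov_chain _ _ _ (fun s => undup (rmoves s)) [set s | 0 < y s]).
- exact: htransform_ge0.
- by rewrite /= y1.
- by move=> u; exact: undup_uniq.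
- by move=> u t; rewrite mem_undup => /remy_P_eq0 h; rewrite /htransform h mulr0 mul0r.
- move=> u /= u0; have := Uy u; rewrite forward_opE_undup => e.
  rewrite -[RHS](mulVf (lt0r_neq0 u0)) -[in X in _ = _ * X]e mulr_sumr.
  by apply: eq_bigr => t _; rewrite mulrA.
- move=> u t /= u0 h; rewrite lt0r y0 andbT; apply: contraTneq h => e.
  by rewrite /htransform e mulr0 ltxx.
Qed.

Lemma pr_bigcup0 d (Omega : measurableType d) (P : probability Omega R) (F : nat -> set Omega) :
  (forall n, measurable (F n)) -> (forall n, pr P (F n) = 0) -> pr P (\bigcup_n F n) = 0.
Proof.
move=> mF F0; rewrite /pr (_ : P _ = 0%E) //.
apply: measure_negligible; first exact: bigcupT_measurable.
apply: negligible_bigcup => n; apply/negligibleP => //.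
by apply/eqP; rewrite pr_eq0 // F0.
Qed.

Lemma remy_marginal s n f :
  \sum_(t <- level (nleaves s - 2 + n)) pr (remy_law R s) [set w | coord_process n w = t] * f t =
  iter n (@forward_op R) f s.
Proof.
have M := remy_law_chain s.
elim: n f => [|n IH] f.
  rewrite addn0; under eq_bigr => t _ do rewrite (mc_init M) mulrC.
  by rewrite (sum_level_delta f) // mem_level_nleaves.
rewrite iterSr -IH addnS.
under eq_bigr => t _ do rewrite (mc_marginal M (remy_P_ge0 R) (@remy_P_nleaves R)) mulr_suml.
rewrite exchange_big /= big_seq [RHS]big_seq; apply: eq_bigr => u un.
by rewrite (forward_opE _ un) mulr_sumr; apply: eq_bigr => t _; rewrite mulrA.
Qed.

Lemma remy_marginal1 s n t : pr (remy_law R s) [set w | coord_process n w = t] =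
  if nleaves t == (nleaves s + n)%N then iter n (@forward_op R) (fun u => (u == t)%:R) s else 0.
Proof.
case: eqP => h.
  rewrite -remy_marginal (sum_level_delta (fun t => pr _ [set w | coord_process n w = t])) //.
  by rewrite mem_level h; have := nleaves_ge2 s; lia.
by apply: (mc_level (remy_law_chain s) (remy_P_ge0 R) (@remy_P_nleaves R)); apply/eqP.
Qed.

(** The number of leaves determines the only time at which [t] can be hit, up to a null event. *)
Lemma hit_prE s t : hit_pr R s t =
  if (nleaves s <= nleaves t)%N then iter (nleaves t - nleaves s) (@forward_op R) (fun u => (u == t)%:R) s else 0.
Proof.
(* If [t] has fewer leaves than [s], the truncated difference is time 0, where [t] has probability
   0. *)
set P := remy_law R s; set m := (nleaves t - nleaves s)%N.
have ms n : measurable ([set w | coord_process n w = t] : set path_space).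
  by apply: measurable_state; exact: measurable_coord.
have -> : hit_pr R s t = pr P [set w | coord_process m w = t].
  rewrite /hit_pr -/(pr P _).
  have -> : [set w | exists n, coord_process n w = t] = [set w | coord_process m w = t] `|`
      \bigcup_n ([set w | coord_process n w = t] `&` ~` [set w | coord_process m w = t]).
    apply/seteqP; split=> w /=.
      move=> [n wn]; have [wm|wm] := pselect (coord_process m w = t); first by left.
      by right; exists n.
    by move=> [wm|[n _ [wn _]]]; [exists m|exists n].
  have mF n : measurable ([set w | coord_process n w = t] `&` ~` [set w | coord_process m w = t] : set path_space).
    by apply: measurableI => //; apply: measurableC.
  rewrite prU //; first last.
  - by apply/seteqP; split=> // w [h [n _ [_]]].
  - exact: bigcupT_measurable.
  rewrite pr_bigcup0 ?addr0 // => n.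
  have [nm|nm] := eqVneq n m; first by rewrite nm setICr pr0.
  apply: (pr_sub0 (mF n) (ms n)); first by move=> w [].
  apply: (mc_level (remy_law_chain s) (remy_P_ge0 R) (@remy_P_nleaves R)).
  by apply: contraNneq nm => h; rewrite /m; lia.
rewrite remy_marginal1; case: (leqP (nleaves s) (nleaves t)) => h.
  by rewrite (_ : (_ == _) = true) //; rewrite /m; lia.
by rewrite (_ : (_ == _) = false) //; rewrite /m; lia.
Qed.

(** Both hitting probabilities are reversed in time by [iter_forward_density]; the factors depending
    on [t] cancel because [density aleph t] is 1. *)
Lemma martin_kernelE s t : martin_kernel R s t = density_ratio R s t.
Proof.
have ta := nleaves_ge2 t; have sa := nleaves_ge2 s.
have key u : (nleaves u <= nleaves t)%N -> iter (nleaves t - nleaves u) (@forward_op R) (fun v => (v == t)%:R) u =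
    level_prob R (nleaves t - 2) * density R u t / level_prob R (nleaves u - 2).
  move=> ut; have ua := nleaves_ge2 u.
  have tn : t \in level ((nleaves t - nleaves u) + (nleaves u - 2)) by rewrite mem_level; lia.
  have := iter_forward_density R (mem_level_nleaves u) tn.
  have -> : (nleaves t - nleaves u + (nleaves u - 2) = nleaves t - 2)%N by lia.
  by move=> <-; rewrite mulrC mulKf ?level_prob_neq0.
rewrite /martin_kernel /density_ratio !hit_prE nleaves_aleph ta.
have -> : (nleaves t - 2 = nleaves t - nleaves aleph)%N by [].
rewrite (key aleph) // density_aleph nleaves_aleph subnn.
case: ifP => st; last by rewrite mul0r.
rewrite (key s) // -[level_prob R 0]/1 mulr1 divr1.
by rewrite mulrAC [_ * density R s t]mulrC mulfK ?level_prob_neq0.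
Qed.
End Laws.

(** * Boundary points as limits along trees of growing size *)

Section Boundary.
Context (R : realType).

Lemma nbhs_ptws_eval (y : {ptws remy_tree -> R}) (s : remy_tree) (A : set R) :
  nbhs (y s) A -> nbhs y [set f : {ptws remy_tree -> R} | A (f s)].
Proof.
move=> nA.
have := @proj_continuous remy_tree (fun=> R) s y A nA.
exact.
Qed.

Lemma ptws_cvg (F : set_system {ptws remy_tree -> R}) (f : {ptws remy_tree -> R}) :
  Filter F -> (forall s, (fun g : remy_tree -> R => g s) @ F --> f s) -> F --> f.
Proof.
move=> FF H; apply/cvg_sup => s; apply/cvg_image.
  by rewrite eqEsubset; split=> // v _; exists (cst v).
move=> W /= nW; rewrite /= nbhs_simpl; exists (@^~ s @^-1` W); first exact: H.
by rewrite eqEsubset; split => [_ [g + <-//]|v Wv]; exists (cst v).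
Qed.

(** Finitely many trees have fewer than [k] leaves, and as [y] is not one of their kernels, some
    neighbourhood of [y] avoids them all. Countability of the states leaves finitely many closeness
    conditions at each stage. *)
Lemma boundary_sequence (y : {ptws remy_tree -> R}) : doob_martin_boundary R y ->
  exists T : nat -> remy_tree, (forall k, (k <= nleaves (T k))%N) /\
    forall s, density_ratio R s (T k) @[k --> \oo] --> y s.
Proof.
move=> [yc yn].
have nclose (e : R) s : 0 < e -> nbhs y [set f : {ptws remy_tree -> R} | `|y s - f s| < e].
  by move=> e0; apply: (@nbhs_ptws_eval y s (ball (y s) e)); exact: nbhsx_ballx.
have nU k : nbhs y [set f : {ptws remy_tree -> R} |
    forall s, (pickle s < k)%N -> `|y s - f s| < k.+1%:R^-1].
  have : forall j, nbhs y [set f : {ptws remy_tree -> R} |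
      forall s, (pickle s < j)%N -> `|y s - f s| < k.+1%:R^-1].
    elim=> [|j IH]; first by apply: filterS filterT => f _.
    have [[t tj]|nt] := pselect (exists t : remy_tree, pickle t = j).
      apply: filterS (filterI IH (nclose (k.+1%:R^-1) t _)); last by rewrite invr_gt0 ltr0n.
      move=> f [/= h1 h2] s; rewrite ltnS leq_eqVlt => /orP[/eqP e|]; last exact: h1.
      have -> // : s = t by apply: (pcan_inj pickleK); rewrite e tj.
    apply: filterS IH => f h s; rewrite ltnS leq_eqVlt => /orP[/eqP e|]; last exact: h.
    by exfalso; apply: nt; exists s.
  exact.
have nV k : nbhs y [set f : {ptws remy_tree -> R} |
    forall t, (nleaves t < k)%N -> f <> (fun s => martin_kernel R s t)].
  have one t : nbhs y [set f : {ptws remy_tree -> R} | f <> (fun s => martin_kernel R s t)].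
    have [s ys] : exists s, y s <> martin_kernel R s t.
      apply/existsNP => h; apply: yn; exists t => //; exact/funext.
    have d0 : 0 < `|y s - martin_kernel R s t| by rewrite normr_gt0 subr_eq0; exact/eqP.
    by apply: filterS (nclose _ s d0) => f /= + fe; rewrite fe ltxx.
  have seqs (l : seq remy_tree) : nbhs y [set f : {ptws remy_tree -> R} |
      forall t, t \in l -> f <> (fun s => martin_kernel R s t)].
    elim: l => [|t l IH]; first by apply: filterS filterT => f _.
    apply: filterS (filterI IH (one t)) => f [/= h1 h2] u.
    by rewrite inE => /orP[/eqP ->//|]; exact: h1.
  apply: filterS (seqs (flatten [seq level n | n <- iota 0 k])) => f h t tk.
  apply: h; apply/flattenP; exists (level (nleaves t - 2)); last exact: mem_level_nleaves.
  by apply: map_f; rewrite mem_iota; have := nleaves_ge2 t; lia.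
have ex k : exists t, (k <= nleaves t)%N /\ forall s, (pickle s < k)%N -> `|y s - density_ratio R s t| < k.+1%:R^-1.
  have [_ [[t _ <-] [h1 h2]]] := yc _ (filterI (nU k) (nV k)).
  exists t; split; first by rewrite leqNgt; apply/negP => /h2.
  by move=> s sk; rewrite -martin_kernelE; exact: h1.
exists (fun k => projT1 (cid (ex k))); split=> [k|s].
  by case: (cid (ex k)) => t [].
apply/cvgrPdist_lt => e e0; near=> k.
have k1 : (pickle s < k)%N by near: k; exact: nbhs_infty_gt.
have k2 : k.+1%:R^-1 < e by near: k; exact: (near_infty_natSinv_lt (PosNum e0)).
by case: (cid (ex k)) => t [_ /= /(_ s k1) h]; apply: lt_trans h k2.
Unshelve. all: by end_near. Qed.

(** The limit is not a kernel: it has mass 1 on every level, while K(., t) vanishes at trees with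
    more leaves than [t]. *)
Lemma sequence_boundary (y : remy_tree -> R) (T : nat -> remy_tree) :
  (forall k, (k <= nleaves (T k))%N) -> (forall s, density_ratio R s (T k) @[k --> \oo] --> y s) ->
  doob_martin_boundary R y.
Proof.
move=> lvT Ty; have Hy := lim_normalized lvT Ty; split.
  have Tc : (fun s => martin_kernel R s (T k) : R) @[k --> \oo] --> (y : {ptws remy_tree -> R}).
    apply: ptws_cvg => s; have := @Ty s.
    rewrite (_ : (fun k => density_ratio R s (T k)) = fun k => martin_kernel R s (T k)); first exact.
    by apply/funext => k; rewrite martin_kernelE.
  move=> B /Tc [N _ NB]; exists (fun s => martin_kernel R s (T N)); split; last exact: (NB N (leqnn N)).
  by exists (T N).
move=> [t _ yt].
have := expect1 Hy (nleaves t); rewrite /expect big_seq big1; first by move/eqP; rewrite eq_sym oner_eq0.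
move=> s; rewrite mem_level => /eqP st.
rewrite -yt martin_kernelE /density_ratio st (_ : (_ <= _)%N = false) ?mulr0 ?mul0r //.
lia.
Qed.
End Boundary.

(** * Bridges *)

Section Shift.
Context (R : realType).

Definition pshift (m : nat) (w : path_space) : path_space := fun n => w (m + n)%N.

Lemma measurable_shift m : measurable_fun setT (pshift m).
Proof.
apply: (@measurability _ _ path_space path_space setT (pshift m) cylinders) => //.
move=> _ [_ [n [t ->]] <-]; rewrite setTI.
exact: (measurable_state (m + n) t measurable_coord).
Qed.

Lemma measurable_shift_preimage m B : measurable B -> measurable (pshift m @^-1` B).
Proof. by move=> mB; rewrite -[X in measurable X]setTI; apply: measurable_shift. Qed.

Lemma shift_past m k v :
  pshift m @^-1` past coord_process k v =
  win coord_process m (m + k) (fun i => v (i - m)%N).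
Proof.
apply/seteqP; split=> w /=; rewrite /past /win /coord_process /pshift /=.
  by move=> h i /andP[mi ik]; rewrite -h; [congr w|]; lia.
by move=> h i ik; rewrite h; [congr v|]; lia.
Qed.

(** Events of the future become preimages under the shift, the form in which laws can be compared on
    pasts. *)
Lemma sigma_from_shift m A : sigma_from coord_process m A ->
  exists2 B, measurable B & A = pshift m @^-1` B.
Proof.
move=> h; have : preimage_set_system setT (pshift m) measurable A.
  move: A h; apply: smallest_sub.
    by apply: sigma_algebra_preimage; exact: sigma_algebra_measurable.
  move=> _ [n [mn [B ->]]]; exists (coord_process (n - m) @^-1` B).
    by have := @measurable_coord (n - m) measurableT B I; rewrite setTI.
  rewrite setTI; apply/seteqP; split=> w /=; rewrite /coord_process /pshift /= subnKC //.
by move=> [B mB <-]; exists B; rewrite ?setTI.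
Qed.

Variable P : probability path_space R.

(** The law of the future from time [m] on, restricted to [D]; a finite measure for
    [path_measure_unique]. *)
Definition shift_restr (D : set path_space) (mD : measurable D) m :
  {measure set path_space -> \bar R} :=
  measure_function_pushforward__canonical__measure_function_Measure
    (mrestr P mD : {measure set path_space -> \bar R}) (measurable_shift m).

Lemma shift_restrE (D : set path_space) (mD : measurable D) m B : measurable B ->
  shift_restr mD m B = (pr P (D `&` pshift m @^-1` B))%:E.
Proof.
move=> mB; rewrite -(prE P); last by apply: measurableI => //; exact: measurable_shift_preimage.
by rewrite setIC.
Qed.

Lemma pr_shift_unique (D D' : set path_space) (c : R) m : measurable D -> measurable D' ->
  0 <= c ->
  (forall k v, pr P (D `&` pshift m @^-1` past coord_process k v) =
     c * pr P (D' `&` pshift m @^-1` past coord_process k v)) ->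
  forall B, measurable B ->
    pr P (D `&` pshift m @^-1` B) = c * pr P (D' `&` pshift m @^-1` B).
Proof.
move=> mD mD' c0 H B mB; apply: EFin_inj; rewrite EFinM -(shift_restrE mD) // -(shift_restrE mD') //.
rewrite -[RHS]/(mscale (NngNum c0) (shift_restr mD' m) B).
have mp k v : measurable (past coord_process k v).
  by apply: measurable_past => i; exact: measurable_coord.
apply: (path_measure_unique (m1 := shift_restr mD m) (m2 := mscale (NngNum c0) (shift_restr mD' m))) => //.
  by rewrite shift_restrE ?ltry.
move=> k v; change (shift_restr mD m (past coord_process k v) = (c%:E * shift_restr mD' m (past coord_process k v))%E).
by rewrite !shift_restrE // H EFinM.
Qed.
End Shift.

(** * Bridges as h-transforms by normalized harmonic functions *)

Section Consistent.
Context (R : realType).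

Lemma backward_kernel_sum1 n t : t \in level n.+1 -> \sum_(s <- level n) backward_kernel R t s = 1.
Proof.
by move=> tn; rewrite -[RHS](backward_op_cst 1 t) (backward_opE _ tn); apply: eq_bigr => s _; rewrite mulr1.
Qed.

Lemma backward_kernel_eq0 n s t : t \in level n.+1 -> s \notin level n -> backward_kernel R t s = 0.
Proof.
rewrite !mem_level => /eqP tn sn; rewrite /backward_kernel (_ : count_mem _ _ = 0%N) ?mul0r //.
apply/count_memPn/mapP => -[i]; rewrite mem_iota => it e; move: sn.
by rewrite e nleaves_rem_leaf tn ?eqxx //; lia.
Qed.

(* [q n] is the law at time [n] of a process with the backward transitions. *)
Lemma consistent_normalized (q : nat -> remy_tree -> R) : (forall n t, 0 <= q n t) ->
  q 0%N aleph = 1 ->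
  (forall n s, s \in level n -> q n s = \sum_(t <- level n.+1) q n.+1 t * backward_kernel R t s) ->
  normalized_harmonic R (fun s => q (nleaves s - 2)%N s / level_prob R (nleaves s - 2)).
Proof.
move=> q0 q1 qS; split.
- by move=> s; rewrite divr_ge0 // ltW // level_prob_gt0.
- apply/harmonicE => s; have sn := mem_level_nleaves s; set n := (nleaves s - 2)%N in sn *.
  rewrite (forward_opE _ sn) qS // mulr_suml big_seq [RHS]big_seq; apply: eq_bigr => t tn.
  have -> : (nleaves t - 2 = n.+1)%N by move: tn; rewrite mem_level => /eqP ->; lia.
  apply: (mulfI (level_prob_neq0 R n)); rewrite [LHS]mulrA (detailed_balance R sn tn).
  have w1 := level_prob_neq0 R n; have w2 := level_prob_neq0 R n.+1.
  by field; rewrite w1 w2.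
- by rewrite -[level_prob R _]/1 q1 divr1.
Qed.

(** A vanishing sum of nonnegative terms. It settles the states at which [htransform] inverts 0. *)
Lemma remy_P_null y s t : normalized_harmonic R y -> y s = 0 -> remy_P R s t * y t = 0.
Proof.
move=> [y0 /harmonicE Uy _] ys.
have [tm|tm] := boolP (t \in rmoves s); last by rewrite remy_P_eq0 ?mul0r.
have := Uy s; rewrite ys forward_opE_undup => /eqP.
rewrite psumr_eq0; last by move=> u _; rewrite mulr_ge0 // remy_P_ge0.
by move=> /allP/(_ t); rewrite mem_undup => /(_ tm) /= /eqP.
Qed.

Section BridgeChain.
Context (d : measure_display) (Omega : measurableType d).
Variables (P : probability Omega R) (X : nat -> Omega -> remy_tree) (y : remy_tree -> R).
Hypothesis Hy : normalized_harmonic R y.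
Hypothesis MC : markov_chain P X aleph (htransform y).

Let y0 s : 0 <= y s. Proof. by have [] := Hy. Qed.
Let mX n : measurable_fun setT (X n). Proof. by have [] := MC. Qed.

(** Detailed balance turns the forward recursion into a sum over a row of the backward kernel, which
    is 1. For constant [y], trees of one level are equally likely. *)
Lemma bridge_marginal n t : pr P [set x | X n x = t] =
  if t \in level n then level_prob R n * y t else 0.
Proof.
have [tn|tn] := boolP (t \in level n); last first.
  apply: (mc_level MC (htransform_ge0 y0) (@htransform_nleaves R y)).
  by move: tn; rewrite mem_level.
elim: n t tn => [|n IH] t tn.
  have [_ _ y1] := Hy; move: tn; rewrite inE => /eqP ->.
  by rewrite (mc_init MC) eqxx y1 mulr1.
rewrite (mc_marginal MC (htransform_ge0 y0) (@htransform_nleaves R y)) nleaves_aleph subnn add0n.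
rewrite -[RHS]mulr1 -(backward_kernel_sum1 tn) mulr_sumr big_seq [RHS]big_seq; apply: eq_bigr => s sn.
rewrite IH // [RHS]mulrAC -(detailed_balance R sn tn) /htransform.
have [ys|ys] := eqVneq (y s) 0; last by field.
by rewrite ys mulr0 mul0r -mulrA remy_P_null // mulr0.
Qed.

(** The factor [y s] of the marginal cancels its inverse in [htransform], so the backward
    transitions do not depend on [y]. *)
Lemma bridge_pair n s t : pr P ([set x | X n x = s] `&` [set x | X n.+1 x = t]) =
  backward_kernel R t s * pr P [set x | X n.+1 x = t].
Proof.
rewrite (mc_pair MC (htransform_ge0 y0)) !bridge_marginal.
have [sn|sn] := boolP (s \in level n); have [tn|tn] := boolP (t \in level n.+1).
- rewrite [RHS]mulrA [backward_kernel R t s * _]mulrC -(detailed_balance R sn tn) /htransform.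
  have [ys|ys] := eqVneq (y s) 0; last by field.
  by rewrite ys mulr0 mul0r -mulrA remy_P_null // mulr0.
- rewrite mulr0; apply/eqP; rewrite mulf_eq0 orbC; apply/orP; left.
  apply: contraNT tn => /htransform_nleaves; rewrite !mem_level => ->.
  by move: sn; rewrite mem_level => /eqP ->.
- by rewrite mul0r (backward_kernel_eq0 tn sn) mul0r.
- by rewrite mul0r mulr0.
Qed.

Lemma cond_prE A B : cond_pr P A B = pr P (A `&` B) / pr P B.
Proof. by []. Qed.
End BridgeChain.

Lemma normalized1 : normalized_harmonic R (fun=> 1).
Proof. by split; [move=> s; exact: ler01|apply/harmonicE => s; exact: forward_op1|]. Qed.

(** The Rémy chain is its own h-transform by the constant 1. *)
Lemma remy_backwardE n s t : t \in level n.+1 -> remy_backward R n s t = backward_kernel R t s.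
Proof.
move=> tn; have M := remy_law_chain R aleph.
have E : remy_P R = htransform (fun=> 1).
  by apply/funext => u; apply/funext => v; rewrite /htransform invr1 mul1r mulr1.
rewrite E in M; rewrite /remy_backward cond_prE (bridge_pair normalized1 M).
rewrite (bridge_marginal normalized1 M) tn mulr1 mulfK //.
exact: level_prob_neq0.
Qed.

Section BridgeOf.
Context (d : measure_display) (Omega : measurableType d).
Variables (P : probability Omega R) (X : nat -> Omega -> remy_tree) (y : remy_tree -> R).
Hypothesis Hy : normalized_harmonic R y.
Hypothesis MC : markov_chain P X aleph (htransform y).

Let y0 s : 0 <= y s. Proof. by have [] := Hy. Qed.
Let mX n : measurable_fun setT (X n). Proof. by have [] := MC. Qed.

Lemma chain_is_bridge : infinite_remy_bridge P X.
Proof.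
have [_ h0 hQ] := MC; split=> //.
- split=> // n w t p0; rewrite hQ //.
  have mp := measurable_past n w mX.
  have ms := measurable_state n (w n) mX.
  rewrite cond_prE setIC (mc_pair MC (htransform_ge0 y0)) mulrC mulKf //.
  apply: contraNneq p0 => e; rewrite pr_eq0 //; apply/eqP.
  by apply: (pr_sub0 mp ms) => // x; exact.
- move=> n.
  have mN : measurable (~` [set x | nb_vertices (sval (X n x)) = (2 * n.+1).+1]).
    apply: measurableC.
    by have := @mX n measurableT [set t : remy_tree | nb_vertices (sval t) = (2 * n.+1).+1] I; rewrite setTI.
  apply/negligibleP => //; apply/eqP; rewrite pr_eq0 //.
  apply/eqP; apply: (pr_null (mX n)) => // t.
  have ms := measurable_state n t mX.
  have [tn|tn] := boolP (t \in level n).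
    rewrite (_ : _ `&` _ = set0) ?pr0 //; apply/seteqP; split=> // x [/= h e]; apply: h.
    by rewrite e; move: tn; rewrite mem_level /nleaves => /eqP h; have := nb_verticesE (sval t); lia.
  apply: (pr_sub0 (measurableI _ _ mN ms) ms); last by rewrite (bridge_marginal Hy MC) (negPf tn).
  by move=> x [].
- move=> n s t; have ms := measurable_state n.+1 t mX; rewrite pr_eq0 // => p0.
  have [tn|tn] := boolP (t \in level n.+1); last first.
    by move: p0; rewrite (bridge_marginal Hy MC) (negPf tn) eqxx.
  by rewrite remy_backwardE // cond_prE (bridge_pair Hy MC) mulfK.
Qed.
End BridgeOf.

Section BridgeIsChain.
Context (d : measure_display) (Omega : measurableType d).
Variables (P : probability Omega R) (X : nat -> Omega -> remy_tree).
Hypothesis HX : infinite_remy_bridge P X.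

(** By [bridge_marginal], [y] can only be the marginal divided by [level_prob]; Bayes' formula then
    recovers the forward transitions from the backward ones. *)
Lemma bridge_is_chain : exists2 y, normalized_harmonic R y &
  markov_chain P X aleph (htransform y).
Proof.
have [[mX mP] h0 hl hb] := HX.
pose q n t := pr P [set x | X n x = t].
have ql n t : t \notin level n -> q n t = 0.
  move=> tn; have ms := measurable_state n t mX.
  rewrite /q /pr (_ : P _ = 0%E) //; apply: measure_negligible => //.
  apply: negligibleS (hl n) => x /= e h; move: tn.
  by rewrite -e mem_level /nleaves; have := nb_verticesE (sval (X n x)); lia.
have qp n s t : pr P ([set x | X n x = s] `&` [set x | X n.+1 x = t]) = q n.+1 t * backward_kernel R t s.
  have m1 := measurable_state n s mX; have m2 := measurable_state n.+1 t mX.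
  have [qt|qt] := eqVneq (q n.+1 t) 0.
    rewrite qt mul0r; apply: (pr_sub0 (measurableI _ _ m1 m2) m2) => //.
  have tn : t \in level n.+1 by apply: contraNT qt => /ql ->.
  have := hb n s t; rewrite pr_eq0 // => /(_ qt).
  by rewrite remy_backwardE // cond_prE => <-; rewrite mulrC divfK.
have qS n s : q n s = \sum_(t <- level n.+1) q n.+1 t * backward_kernel R t s.
  rewrite /q (@pr_sum _ _ _ P (X n.+1) (level n.+1)) ?level_uniq //; last first.
    exact: ql.
    exact: measurable_state.
  by apply: eq_bigr => t _; rewrite qp.
have q1 : q 0%N aleph = 1 by rewrite /q /pr h0.
have q0 n t : 0 <= q n t by exact: pr_ge0.
have Hy := consistent_normalized q0 q1 (fun n s _ => qS n s).
exists (fun s => q (nleaves s - 2)%N s / level_prob R (nleaves s - 2)) => //; split=> // n w t p0.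
rewrite mP // cond_prE setIC qp -/(q n (w n)).
have qw : q n (w n) != 0.
  apply: contraNneq p0 => e; have mp := measurable_past n w mX.
  rewrite pr_eq0 //; apply/eqP; apply: (pr_sub0 mp (measurable_state n (w n) mX)) => //.
  by move=> x; exact.
have wn : w n \in level n by apply: contraNT qw => /ql ->.
rewrite /htransform.
have -> : (nleaves (w n) - 2 = n)%N by move: wn; rewrite mem_level => /eqP ->; lia.
have [tn|tn] := boolP (t \in level n.+1); last first.
  rewrite (ql _ _ tn) !mul0r (_ : remy_P R (w n) t = 0) ?mulr0 ?mul0r //.
  apply: contraNeq tn => /remy_P_nleaves; rewrite !mem_level => ->.
  by move: wn; rewrite mem_level => /eqP ->.
have -> : (nleaves t - 2 = n.+1)%N by move: tn; rewrite mem_level => /eqP ->; lia.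
have w1 := level_prob_neq0 R n; have w2 := level_prob_neq0 R n.+1.
have E : backward_kernel R t (w n) = level_prob R n * remy_P R (w n) t / level_prob R n.+1.
  by rewrite (detailed_balance R wn tn) mulrC mulKf.
by rewrite E; field; rewrite w1 w2 qw.
Qed.
End BridgeIsChain.
End Consistent.

(** * Tail events *)

Lemma win_ext (Omega : Type) (X : nat -> Omega -> remy_tree) k n v w :
  (forall i, (k <= i <= n)%N -> v i = w i) -> win X k n v = win X k n w.
Proof.
by move=> vw; apply/seteqP; split=> x h i ik; rewrite h // vw.
Qed.

Lemma pshiftD m n w : pshift n (pshift m w) = pshift (m + n) w.
Proof. by apply/funext => i; rewrite /pshift addnA. Qed.

Section Tail.
Context (R : realType) (P : probability path_space R) (y : remy_tree -> R).
Hypothesis Hy : normalized_harmonic R y.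
Hypothesis MC : markov_chain P coord_process aleph (htransform y).

Let y0 s : 0 <= y s. Proof. by have [] := Hy. Qed.

Local Notation at_ n t := [set w : path_space | coord_process n w = t].

Lemma measurable_at n t : measurable (at_ n t).
Proof. exact: (measurable_state n t measurable_coord). Qed.

(** The reversed Markov property: given the state at [n.+1], the state at [n] is independent of the
    future. By [pr_shift_unique] it is a product formula on pasts. *)
Lemma backward_shift n s t B : measurable B ->
  pr P (at_ n s `&` at_ n.+1 t `&` pshift n.+1 @^-1` B) =
  backward_kernel R t s * pr P (at_ n.+1 t `&` pshift n.+1 @^-1` B).
Proof.
apply: pr_shift_unique.
- by apply: measurableI; exact: measurable_at.
- exact: measurable_at.
- exact: backward_kernel_ge0.
move=> k v; rewrite shift_past; set v' := fun i => v (i - n.+1)%N.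
have v'n : v' n.+1 = v 0%N by rewrite /v' subnn.
have [vt|vt] := eqVneq (v 0%N) t; last first.
  have E : at_ n.+1 t `&` win coord_process n.+1 (n.+1 + k) v' = set0.
    apply/seteqP; split=> // w [/= wt /(_ n.+1)]; rewrite leqnn leq_addr => /(_ isT).
    by rewrite wt v'n => /esym/eqP; rewrite (negPf vt).
  by rewrite -setIA E setI0 pr0 mulr0.
have E : at_ n.+1 t `&` win coord_process n.+1 (n.+1 + k) v' = win coord_process n.+1 (n.+1 + k) v'.
  apply/setIidPr => w /(_ n.+1); rewrite leqnn leq_addr => /(_ isT) /= ->.
  by rewrite v'n.
rewrite -setIA E setIC win_upd; last by lia.
have e1 : (n.+1 + k = k.+1 + n)%N by lia.
have e2 : (n.+1 + k = k + n.+1)%N by lia.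
rewrite {1}e1 e2 (mc_win_prod MC (htransform_ge0 y0)) (mc_win_prod MC (htransform_ge0 y0)).
rewrite big_ord_recl /= add0n mulrA mulrA; congr (_ * _).
  have -> : upd v' n s n = s by rewrite /upd eqxx.
  have -> : upd v' n s n.+1 = t by rewrite /upd (_ : (n.+1 == n) = false) ?v'n //; lia.
  by rewrite v'n vt -(bridge_pair Hy MC) (mc_pair MC (htransform_ge0 y0)).
apply: eq_bigr => i _; rewrite /upd /bump leq0n.
have -> : (1 + i + n == n)%N = false by lia.
have -> : ((1 + i + n).+1 == n)%N = false by lia.
by rewrite (_ : (1 + i + n = i + n.+1)%N) //; lia.
Qed.

(** [backward_shift] iterated: [iter l backward_op g] at time [l + n] is the conditional expectation
    of [g] at time [n] given the future. *)
Lemma cond_back n l g B : measurable B ->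
  \sum_(s <- level n) g s * pr P (at_ n s `&` pshift (l + n) @^-1` B) =
  \sum_(t <- level (l + n)) iter l (@backward_op R) g t * pr P (at_ (l + n) t `&` pshift (l + n) @^-1` B).
Proof.
elim: l n g => [//|l IH] n g mB.
have mB' : measurable (pshift l @^-1` B) by exact: measurable_shift_preimage.
have E : pshift (l.+1 + n) @^-1` B = pshift n.+1 @^-1` (pshift l @^-1` B).
  by apply/funext => w /=; rewrite pshiftD; congr (B (pshift _ w)); lia.
have e : (l.+1 + n = l + n.+1)%N by lia.
rewrite iterSr [in RHS]e -(IH n.+1) // -[in RHS]e E.
have step s : pr P (at_ n s `&` pshift n.+1 @^-1` (pshift l @^-1` B)) =
    \sum_(t <- level n.+1) backward_kernel R t s * pr P (at_ n.+1 t `&` pshift n.+1 @^-1` (pshift l @^-1` B)).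
  rewrite (mc_sum MC (htransform_ge0 y0) (@htransform_nleaves R y) n.+1); last first.
    by apply: measurableI; [exact: measurable_at|exact: measurable_shift_preimage].
  rewrite nleaves_aleph subnn add0n; apply: eq_bigr => t _.
  by rewrite -backward_shift // setIAC.
under eq_bigr do rewrite step mulr_sumr.
rewrite exchange_big /= big_seq [RHS]big_seq; apply: eq_bigr => t tn.
rewrite (backward_opE _ tn) mulr_suml; apply: eq_bigr => s _.
by rewrite mulrA [g s * _]mulrC.
Qed.

Lemma expect_pr n f : expect y n f = \sum_(t <- level n) pr P (at_ n t) * f t.
Proof. by apply: eq_big_seq => t tn; rewrite (bridge_marginal Hy MC) tn. Qed.

(** Equivalent to [tail_sigma] for the coordinate process, see [tail_sigma_event] and
    [tail_event_sigma], and in the form that [backward_shift] takes. *)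
Definition tail_event A := forall m, exists2 B, measurable B & A = pshift m @^-1` B.

Lemma tail_sigma_event A : tail_sigma coord_process A -> tail_event A.
Proof. by move=> tA m; apply: sigma_from_shift; exact: tA. Qed.

Lemma tail_event_measurable A : tail_event A -> measurable A.
Proof. by move=> /(_ 0%N) [B mB ->]; exact: measurable_shift_preimage. Qed.

Lemma tail_eventC A : tail_event A -> tail_event (~` A).
Proof.
by move=> tA m; have [B mB ->] := tA m; exists (~` B); [exact: measurableC|].
Qed.

(** [A] belongs to the future of every time, so conditioning on it preserves the backward
    transitions. *)
Lemma tail_harmonic A : tail_event A -> pr P A != 0 ->
  normalized_harmonic R (fun s => pr P (A `&` at_ (nleaves s - 2) s) / pr P A / level_prob R (nleaves s - 2)).
Proof.
move=> tA A0; have mA := tail_event_measurable tA.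
apply: (consistent_normalized (q := fun n s => pr P (A `&` at_ n s) / pr P A)).
- by move=> n s; rewrite divr_ge0 ?pr_ge0.
- have := mc_sum MC (htransform_ge0 y0) (@htransform_nleaves R y) 0 mA.
  by rewrite nleaves_aleph subnn addn0 big_seq1 => <-; rewrite divff.
move=> n s sn; rewrite (mc_sum MC (htransform_ge0 y0) (@htransform_nleaves R y) n.+1); last first.
  by apply: measurableI => //; exact: measurable_at.
rewrite nleaves_aleph subnn add0n mulr_suml; apply: eq_bigr => t _.
have [B mB AB] := tA n.+1.
have -> : A `&` at_ n s `&` at_ n.+1 t = at_ n s `&` at_ n.+1 t `&` pshift n.+1 @^-1` B.
  by rewrite -AB -setIA setIC.
by rewrite backward_shift // -AB [_ `&` A]setIC [RHS]mulrC mulrA.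
Qed.

(** Independence of single states extends to windows by adding earlier states, then to all events by
    uniqueness of measures, in particular to [A] itself. *)
Lemma tail_independent A : tail_event A ->
  (forall n s, pr P (A `&` at_ n s) = pr P A * pr P (at_ n s)) ->
  pr P A = pr P A * pr P A.
Proof.
move=> tA base; have mA := tail_event_measurable tA.
have W k n w : (k <= n)%N -> pr P (A `&` win coord_process k n w) =
    pr P A * pr P (win coord_process k n w).
  move=> kn; rewrite -(subnK kn); move: (n - k)%N => j; clear kn n; elim: j k => [|j IH] k.
    by rewrite add0n win1 base.
  have [B mB AB] := tA k.+1.
  pose C := past coord_process j (fun i => w (k.+1 + i)%N).
  have mC : measurable C by apply: measurable_past => i; exact: measurable_coord.
  have EC : win coord_process k.+1 (j + k.+1) w = pshift k.+1 @^-1` C.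
    by rewrite shift_past addnC; apply: win_ext => i ik; congr w; lia.
  have e : (j.+1 + k = j + k.+1)%N by lia.
  have Ew : win coord_process k (j.+1 + k) w = at_ k (w k) `&` at_ k.+1 (w k.+1) `&` pshift k.+1 @^-1` C.
    rewrite -setIA -EC e; have -> : at_ k.+1 (w k.+1) `&` win coord_process k.+1 (j + k.+1) w =
        win coord_process k.+1 (j + k.+1) w.
      by apply/setIidPr => x; apply; lia.
    rewrite setIC win_upd; last by lia.
    by apply: win_ext => i _; rewrite /upd; case: eqP => // ->.
  have Ew' : win coord_process k.+1 (j + k.+1) w = at_ k.+1 (w k.+1) `&` pshift k.+1 @^-1` C.
    by rewrite -EC; apply/esym/setIidPr => x; apply; lia.
  have mBC : measurable (B `&` C) by exact: measurableI.
  (* The first state of the window contributes the same factor with [A], for D = B [&] C, as without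
     it, for D = C. *)
  have key D : measurable D -> pr P (at_ k (w k) `&` at_ k.+1 (w k.+1) `&` pshift k.+1 @^-1` D) =
      backward_kernel R (w k.+1) (w k) * pr P (at_ k.+1 (w k.+1) `&` pshift k.+1 @^-1` D).
    exact: backward_shift.
  have := IH k.+1; rewrite Ew Ew' {1}AB setICA -preimage_setI => IHk.
  by rewrite {1}AB setICA -preimage_setI !key // IHk mulrCA.
have := @pr_shift_unique R P A setT (pr P A) 0 mA measurableT (pr_ge0 P A).
have E0 D : pshift 0 @^-1` D = D by [].
move=> /(_ _ A mA); rewrite E0 setIid setTI; apply => k v.
by rewrite E0 setTI past_win W.
Qed.

(** If 0 < P A < 1, then [y] is a mixture of the harmonic functions obtained by conditioning on [A]
    and on its complement. Extremality identifies the first with [y], so [A] is independent of each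
    state and P A = (P A)^2. *)
Lemma extreme_tail_trivial : extreme_point (normalized_harmonic R) y ->
  tail_trivial P coord_process.
Proof.
move=> [_ ext] A /tail_sigma_event tA; have mA := tail_event_measurable tA.
suff : pr P A = 0 \/ pr P A = 1.
  by case=> h; [left|right]; rewrite prE // h.
have [->|A0] := eqVneq (pr P A) 0; first by left.
have [->|A1] := eqVneq (pr P A) 1; first by right.
have tC := tail_eventC tA.
have C0 : pr P (~` A) != 0 by rewrite pr_setC // subr_eq0 eq_sym.
have u01 : 0 < pr P A < 1.
  by rewrite lt0r A0 pr_ge0 /= lt_neqAle A1 pr_le1.
have yE s : y s = pr P (at_ (nleaves s - 2) s) / level_prob R (nleaves s - 2).
  by rewrite (bridge_marginal Hy MC) mem_level_nleaves mulrC mulKf ?level_prob_neq0.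
have [|aE _] := ext _ _ _ (tail_harmonic tA A0) (tail_harmonic tC C0) u01.
  apply/funext => s; rewrite yE; set n := (nleaves s - 2)%N.
  have w0 := level_prob_neq0 R n.
  have -> : at_ n s = (A `&` at_ n s) `|` (~` A `&` at_ n s) by rewrite -setIUl setUv setTI.
  rewrite prU; first last.
  - by apply/seteqP; split=> // w [[/= h _] [h' _]].
  - by apply: measurableI; [exact: measurableC|exact: measurable_at].
  - by apply: measurableI => //; exact: measurable_at.
  have -> : (pr P A *: (fun s => pr P (A `&` at_ (nleaves s - 2) s) / pr P A / level_prob R (nleaves s - 2)) +
    (1 - pr P A) *: (fun s => pr P (~` A `&` at_ (nleaves s - 2) s) / pr P (~` A) / level_prob R (nleaves s - 2))) s =
    pr P A * (pr P (A `&` at_ n s) / pr P A / level_prob R n) +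
    (1 - pr P A) * (pr P (~` A `&` at_ n s) / pr P (~` A) / level_prob R n) by [].
  rewrite -pr_setC //; move: A0 C0 w0.
  by move: (pr P (~` A)) (pr P A) (level_prob R n) => a b c a0 b0 c0; field; rewrite a0 b0 c0.
right; have := tail_independent tA _ => h.
have : pr P A * (1 - pr P A) = 0.
  rewrite mulrBr mulr1 -h ?subrr // => n s.
  have [sn|sn] := boolP (s \in level n); last first.
    have z : pr P (at_ n s) = 0 by rewrite (bridge_marginal Hy MC) (negPf sn).
    rewrite z mulr0; apply: (pr_sub0 _ (measurable_at n s)) => //.
      by apply: measurableI => //; exact: measurable_at.
  have nE : (nleaves s - 2 = n)%N by move: sn; rewrite mem_level => /eqP ->; lia.
  have := congr1 (fun f => f s) aE; rewrite /= yE nE => /(mulIf (invr_neq0 (level_prob_neq0 R n))).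
  by move=> <-; rewrite mulrC divfK.
by move/eqP; rewrite mulf_eq0 (negPf A0) /= subr_eq0 => /eqP.
Qed.
End Tail.

(** * Concentration under a trivial tail *)

Section Continuity.
Context (R : realType) (d : measure_display) (Omega : measurableType d).
Variable (P : probability Omega R).

Lemma pr_setU_le A B : measurable A -> measurable B -> pr P (A `|` B) <= pr P A + pr P B.
Proof.
move=> mA mB; have mAB : measurable (B `\` A) by exact: measurableD.
have -> : A `|` B = A `|` (B `\` A).
  by apply/seteqP; split=> x /=; have [|] := pselect (A x); tauto.
rewrite prU //; last by apply/seteqP; split=> // x [Ax [_ /(_ Ax)]].
by rewrite lerD2l; apply: pr_le => // x [].
Qed.

Lemma pr_continuity_below (F : nat -> set Omega) (e : R) : (forall n, measurable (F n)) ->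
  (forall n, F n `<=` F n.+1) -> pr P (\bigcup_n F n) = 1 -> 0 < e ->
  exists n, 1 - e <= pr P (F n).
Proof.
move=> mF ndF F1 e0.
have mU : measurable (\bigcup_n F n) by exact: bigcupT_measurable.
have nd : nondecreasing_seq F.
  by apply/nondecreasing_seqP => n; apply/subsetPset.
have h := nondecreasing_cvg_mu (mu := P) mF mU nd.
have {}h : pr P (F n) @[n --> \oo] --> (1 : R).
  apply: fine_cvg; move: h; rewrite -F1 -(prE P) //; exact.
move/cvgrPdist_le : h => /(_ _ e0) [N _ HN].
by exists N; have := HN N (leqnn N); rewrite /= ler_norml => /andP[_]; lra.
Qed.
End Continuity.

(** For an arbitrary process, so that a trivial tail of [X] can be transported to its law on
    paths. *)
Lemma sigma_from_preimage d (Omega : measurableType d) (X : nat -> Omega -> remy_tree) m B :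
  measurable B -> sigma_from X m [set x | B (pshift m (fun n => X n x))].
Proof.
have h : sigma_algebra [set: path_space]
    (image_set_system setT (fun x => pshift m (fun n => X n x)) (sigma_from X m)).
  by apply: sigma_algebra_image; exact: smallest_sigma_algebra.
suff sub : @measurable _ path_space `<=`
    image_set_system setT (fun x => pshift m (fun n => X n x)) (sigma_from X m).
  by move=> /sub; rewrite /image_set_system /= setTI.
apply: smallest_sub h _ => _ [n [t ->]]; rewrite /image_set_system /= setTI.
apply: sub_sigma_algebra; exists (m + n)%N; split; first exact: leq_addr.
by exists [set t].
Qed.

Lemma tail_event_sigma A : tail_event A -> tail_sigma coord_process A.
Proof. by move=> tA m _; have [B mB ->] := tA m; exact: (@sigma_from_preimage _ path_space coord_process m B mB). Qed.

Section Concentration.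
Context (R : realType) (P : probability path_space R) (y : remy_tree -> R).
Hypothesis Hy : normalized_harmonic R y.
Hypothesis MC : markov_chain P coord_process aleph (htransform y).
Hypothesis TT : tail_trivial P coord_process.
Variables (m : nat) (f : remy_tree -> R).
Hypothesis f01 : forall s, 0 <= f s <= 1.

Let y0 s : 0 <= y s. Proof. by have [] := Hy. Qed.

Local Notation at_ n t := [set w : path_space | coord_process n w = t].
Local Notation g k := (iter k (@backward_op R) f).

Let e k := expect y (k + m) (fun t => g k t ^+ 2).

Let g01 k t : 0 <= g k t <= 1.
Proof.
elim: k t => [|k IH] t; first exact: f01.
by apply: backward_op_between => i _; exact: IH.
Qed.

Lemma measurable_event n (phi : remy_tree -> Prop) :
  measurable [set w : path_space | phi (coord_process n w)].
Proof. by have := @measurable_coord n measurableT [set t | phi t] I; rewrite setTI. Qed.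

Lemma pr_event n (phi : pred remy_tree) : pr P [set w | phi (coord_process n w)] =
  \sum_(t <- level n) pr P (at_ n t) * (phi t)%:R.
Proof.
rewrite (mc_sum MC (htransform_ge0 y0) (@htransform_nleaves R y) n); last first.
  exact: (@measurable_event n (fun t => phi t)).
rewrite nleaves_aleph subnn add0n; apply: eq_bigr => t _.
have [pt|pt] := boolP (phi t).
  rewrite mulr1; apply: (congr1 (pr P)); apply/seteqP; split=> w; first by case.
  by move=> /= wt; split=> //=; rewrite wt.
rewrite mulr0 (_ : _ `&` _ = set0) ?pr0 //; apply/seteqP; split=> // w [/= h wt].
by move: h; rewrite wt (negPf pt).
Qed.

Lemma pr_marginals n N t : pr P (at_ N t) = \sum_(s <- level n) pr P (at_ n s `&` at_ N t).
Proof.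
rewrite (mc_sum MC (htransform_ge0 y0) (@htransform_nleaves R y) n); last exact: measurable_at.
by rewrite nleaves_aleph subnn add0n; apply: eq_bigr => s _; rewrite setIC.
Qed.

Lemma cross_moment n l h t : t \in level (l + n) ->
  \sum_(s <- level n) h s * pr P (at_ n s `&` at_ (l + n) t) =
  iter l (@backward_op R) h t * pr P (at_ (l + n) t).
Proof.
(* [cond_back] for the event of being at [t] at time [l + n], which leaves one term on the right. *)
move=> tN; have mB : measurable [set w : path_space | coord_process 0 w = t] by exact: measurable_at.
have := cond_back Hy MC n l h mB.
have -> : pshift (l + n) @^-1` [set w : path_space | coord_process 0 w = t] = at_ (l + n) t.
  by apply/seteqP; split=> w; rewrite /= /coord_process /pshift addn0.
move=> ->; rewrite (bigD1_seq t) ?level_uniq //= setIid big1 ?addr0 // => u ut.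
rewrite (_ : _ `&` _ = set0) ?pr0 ?mulr0 //; apply/seteqP; split=> // w [/= -> e'].
by rewrite e' eqxx in ut.
Qed.

(* Chebyshev's inequality, with the orthogonality of the increments of the
   reverse martingale [g k (X (k + m))]. *)
Lemma increment_chebyshev k l (dl : R) : 0 < dl ->
  pr P [set w | dl < `|g k (coord_process (k + m) w) - g (l + k) (coord_process (l + (k + m)) w)|] *
    dl ^+ 2 <= e k - e (l + k).
Proof.
move=> d0; set n := (k + m)%N; set N := (l + n)%N.
set E := [set w | _].
have mE : measurable E.
  have -> : E = \bigcup_i (if unpickle i is Some (s, t) then
      [set w : path_space | dl < `|g k s - g (l + k) t|] `&` (at_ n s `&` at_ N t) else set0).
    apply/seteqP; split=> w.
      by move=> Ew; exists (pickle (coord_process n w, coord_process N w)) => //; rewrite pickleK.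
    by move=> [i _]; case: (unpickle i) => [[s t]|//] [/= h [ws wt]]; rewrite /E /= ws wt.
  apply: bigcupT_measurable => i; case: (unpickle i) => [[s t]|]; last exact: measurable0.
  apply: measurableI; last by apply: measurableI; exact: measurable_at.
  case: (dl < _) => /=.
    by rewrite (_ : [set w | _] = setT); [exact: measurableT|apply/seteqP; split].
  by rewrite (_ : [set w | _] = set0); [exact: measurable0|apply/seteqP; split].
have -> : pr P E = \sum_(t <- level N) \sum_(s <- level n) pr P (E `&` at_ N t `&` at_ n s).
  rewrite (mc_sum MC (htransform_ge0 y0) (@htransform_nleaves R y) N) // nleaves_aleph subnn add0n.
  apply: eq_bigr => t _.
  rewrite (mc_sum MC (htransform_ge0 y0) (@htransform_nleaves R y) n); last first.
    by apply: measurableI => //; exact: measurable_at.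
  by rewrite nleaves_aleph subnn add0n.
have -> : e k - e (l + k) = \sum_(t <- level N) \sum_(s <- level n)
    pr P (at_ n s `&` at_ N t) * (g k s - g (l + k) t) ^+ 2.
  have E1 : e k = \sum_(t <- level N) \sum_(s <- level n) pr P (at_ n s `&` at_ N t) * g k s ^+ 2.
    rewrite /e (expect_pr Hy MC) exchange_big /=; apply: eq_bigr => s _.
    by rewrite (pr_marginals N) mulr_suml; apply: eq_bigr => t _; rewrite setIC.
  have E2 : e (l + k) = \sum_(t <- level N) \sum_(s <- level n) pr P (at_ n s `&` at_ N t) * g (l + k) t ^+ 2.
    rewrite /e (expect_pr Hy MC) -addnA; apply: eq_bigr => t _.
    by rewrite {1}(pr_marginals n) mulr_suml.
  (* Orthogonality: the mixed moment equals the later second moment. *)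
  have E3 : e (l + k) = \sum_(t <- level N) \sum_(s <- level n) pr P (at_ n s `&` at_ N t) * (g k s * g (l + k) t).
    rewrite /e (expect_pr Hy MC) -addnA; apply: eq_big_seq => t tN.
    transitivity (g (l + k) t * \sum_(s <- level n) g k s * pr P (at_ n s `&` at_ N t)).
      by rewrite (cross_moment (g k) tN) -iterD /N /n; ring.
    by rewrite mulr_sumr; apply: eq_bigr => s _; ring.
  have -> : e k - e (l + k) = e k - 2 * e (l + k) + e (l + k) by ring.
  rewrite {1}E3 E1 {1}E2 mulr_sumr -sumrB -big_split /=; apply: eq_bigr => t _.
  by rewrite mulr_sumr -sumrB -big_split /=; apply: eq_bigr => s _; ring.
rewrite mulr_suml; apply: ler_sum => t _; rewrite mulr_suml; apply: ler_sum => s _.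
have [h|h] := ltP dl `|g k s - g (l + k) t|.
  apply: ler_pM; rewrite ?pr_ge0 ?sqr_ge0 //.
    apply: pr_le; last by move=> w [[]].
      by do 2?apply: measurableI => //; exact: measurable_at.
    by apply: measurableI; exact: measurable_at.
  by rewrite -[leRHS]real_normK ?num_real //; apply: lerXn2r; rewrite ?nnegrE ?normr_ge0 // ltW.
rewrite (_ : _ `&` _ = set0) ?pr0 ?mul0r; first by apply: mulr_ge0; [exact: pr_ge0|exact: sqr_ge0].
apply/seteqP; split=> // w [[Ew /= wt] /= ws].
by move: Ew; rewrite /E /= ws wt ltNge h.
Qed.

Lemma second_moment_noninc k l : e (l + k) <= e k.
Proof.
rewrite -subr_ge0; apply: le_trans (increment_chebyshev k l ltr01).
by apply: mulr_ge0; [exact: pr_ge0|exact: sqr_ge0].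
Qed.

(** The second moments decrease and are bounded below. With jumps larger than 2^-j, Chebyshev turns
    8^-j into a probability 8^-j / 4^-j = 2^-j. *)
Lemma second_moment_cauchy j : exists N, forall k l, (N <= k)%N ->
  e k - e (l + k) <= (8%:R^-1) ^+ j.
Proof.
have e_ge0 k : 0 <= e k.
  rewrite /e /expect big_seq; apply: sumr_ge0 => t _.
  by apply: mulr_ge0; [apply: mulr_ge0; [exact/ltW/level_prob_gt0|exact: y0]|exact: sqr_ge0].
have hi : has_inf (range e).
  by split; [exists (e 0%N); exists 0%N|exists 0 => _ [k _ <-]; exact: e_ge0].
have d0 : 0 < (8%:R^-1 : R) ^+ j by rewrite exprn_gt0 // invr_gt0 ltr0n.
have [_ [N _ <-] hN] := inf_adherent d0 hi.
exists N => k l Nk.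
have h1 : e k <= e N by rewrite -(subnK Nk); exact: second_moment_noninc.
have h2 : inf (range e) <= e (l + k) by apply: ge_inf; [exact: hi.2|exists (l + k)%N].
lra.
Qed.

(* Along these times the martingale converges fast enough for Borel-Cantelli. *)
Definition fast_index (j : nat) : nat := projT1 (cid (second_moment_cauchy j)).

Fixpoint fast (j : nat) : nat :=
  if j is j'.+1 then maxn (fast_index j) (fast j').+1 else fast_index 0.

Lemma fast_cauchy j l : e (fast j) - e (l + fast j) <= (8%:R^-1) ^+ j.
Proof.
rewrite -/(fast_index j); have : (fast_index j <= fast j)%N by case: j => //= j; exact: leq_maxl.
by rewrite {1}/fast_index; case: cid => N /= H; exact: H.
Qed.

Lemma fast_lt j : (fast j < fast j.+1)%N.
Proof. by rewrite /= leq_max ltnSn orbT. Qed.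

Lemma fast_ge j : (j <= fast j)%N.
Proof. by elim: j => // j IH; apply: leq_ltn_trans (fast_lt j). Qed.

Let Z j (w : path_space) : R := g (fast j) (coord_process (fast j + m) w).
Let eps j : R := (2^-1) ^+ j.

Let Z01 j w : 0 <= Z j w <= 1. Proof. exact: g01. Qed.

Let eps_gt0 j : 0 < eps j. Proof. by rewrite exprn_gt0. Qed.

Lemma measurable_Z (A : set R) j : measurable [set w | A (Z j w)].
Proof. exact: (measurable_event (fast j + m) (fun t => A (g (fast j) t))). Qed.

Definition jump j : set path_space := [set w | eps j < `|Z j w - Z j.+1 w|].

Lemma measurable_jump j : measurable (jump j).
Proof.
have -> : jump j = \bigcup_i (if unpickle i is Some (s, t) then
    [set w | eps j < `|g (fast j) s - g (fast j.+1) t|] `&`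
    (at_ (fast j + m) s `&` at_ (fast j.+1 + m) t) else set0).
  apply/seteqP; split=> w.
    by move=> Ew; exists (pickle (coord_process (fast j + m) w, coord_process (fast j.+1 + m) w)) => //; rewrite pickleK.
  by move=> [i _]; case: (unpickle i) => [[s t]|//] [/= h [ws wt]]; rewrite /jump /Z /= ws wt.
apply: bigcupT_measurable => i; case: (unpickle i) => [[s t]|]; last exact: measurable0.
apply: measurableI; last by apply: measurableI; exact: measurable_at.
case: (eps j < _) => /=.
  by rewrite (_ : [set w | _] = setT); [exact: measurableT|apply/seteqP; split].
by rewrite (_ : [set w | _] = set0); [exact: measurable0|apply/seteqP; split].
Qed.

Lemma pr_jump j : pr P (jump j) <= eps j.
Proof.
have := increment_chebyshev (fast j) (fast j.+1 - fast j) (eps_gt0 j).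
rewrite addnA subnK ?(ltnW (fast_lt j)) // => h.
have h2 := fast_cauchy j (fast j.+1 - fast j).
rewrite subnK ?(ltnW (fast_lt j)) // in h2.
have {}h := le_trans h h2.
have e2 : 0 < eps j ^+ 2 by rewrite exprn_gt0.
rewrite -(ler_pM2r e2); apply: le_trans h _.
rewrite -exprS /eps -exprM mulnC exprM.
have -> // : 8%:R^-1 = 2^-1 ^+ 3 :> R by rewrite exprVn -natrX.
Qed.

(** A finite horizon suffices, because the bounds below are uniform in [n]. *)
Fixpoint jumps J n : set path_space :=
  if n is n'.+1 then jumps J n' `|` jump (J + n') else set0.

Lemma measurable_jumps J n : measurable (jumps J n).
Proof.
elim: n => [|n IH] /=; first exact: measurable0.
by apply: measurableU => //; exact: measurable_jump.
Qed.

Let epsS j : eps j.+1 = eps j / 2.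
Proof. by rewrite /eps exprS mulrC. Qed.

Lemma pr_jumps J n : pr P (jumps J n) <= 2 * eps J.
Proof.
suff : pr P (jumps J n) <= 2 * eps J - 2 * eps (J + n).
  by move=> h; apply: le_trans h _; have := eps_gt0 (J + n); lra.
elim: n => [|n IH] /=; first by rewrite pr0 addn0 subrr.
apply: le_trans (pr_setU_le _ (measurable_jumps J n) (measurable_jump _)) _.
have := pr_jump (J + n); rewrite addnS epsS; lra.
Qed.

Lemma no_jumps J n w : ~ jumps J n w -> `|Z J w - Z (J + n) w| <= 2 * eps J.
Proof.
move=> h; suff : `|Z J w - Z (J + n) w| <= 2 * eps J - 2 * eps (J + n).
  by move=> h'; apply: le_trans h' _; have := eps_gt0 (J + n); lra.
elim: n h => [|n IH] /=; first by rewrite addn0 !subrr normr0.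
move=> /not_orP[/IH h1 h2].
have {}h2 : `|Z (J + n) w - Z (J + n).+1 w| <= eps (J + n).
  by rewrite leNgt; apply/negP.
have := ler_distD (Z (J + n) w) (Z J w) (Z (J + n).+1 w).
by rewrite addnS epsS; lra.
Qed.

Lemma jumps_sub J n i : (i <= n)%N -> jumps J i `<=` jumps J n.
Proof.
move=> /subnK <-; elim: (n - i)%N => // k IH w /IH h; by left.
Qed.

(** The zero-one law for these events locates the limit of [Z] without constructing it as a random
    variable. *)
Definition often_below q : set path_space := [set w | forall j0, exists2 j, (j0 <= j)%N & Z j w <= q].

Lemma often_below_tail q : tail_event (often_below q).
Proof.
move=> m'.
pose B : set path_space := \bigcap_j0 \bigcup_(j in [set j | (maxn j0 m' <= j)%N])
  [set v : path_space | g (fast j) (coord_process (fast j + m - m') v) <= q].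
exists B.
  apply: bigcapT_measurable => j0; apply: bigcup_measurable => j _.
  exact: (measurable_event (fast j + m - m') (fun t => g (fast j) t <= q)).
have E j w : (m' <= j)%N -> coord_process (fast j + m - m') (pshift m' w) = coord_process (fast j + m) w.
  move=> mj; rewrite /coord_process /pshift subnKC //.
  by apply: leq_trans mj _; apply: leq_trans (fast_ge j) _; exact: leq_addr.
apply/seteqP; split=> w.
  move=> h j0 _; have [j] := h (maxn j0 m'); rewrite geq_max => /andP[h1 h2] h3.
  by exists j; rewrite /= ?geq_max ?h1 //= E.
move=> h j0; have [j /=] := h j0 I; rewrite geq_max => /andP[h1 h2] h3; exists j => //.
by rewrite E in h3.
Qed.

Lemma often_below_01 q : pr P (often_below q) = 0 \/ pr P (often_below q) = 1.
Proof.
have := TT (tail_event_sigma (@often_below_tail q)).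
by rewrite /pr => -[->|->]; [left|right].
Qed.

Lemma pr_full A B : measurable A -> measurable B -> A `<=` B -> pr P A = 1 -> pr P B = 1.
Proof. by move=> mA mB AB A1; apply/le_anti; rewrite pr_le1 //= -A1 pr_le. Qed.

(** Some value after [J] is at most [q], within a finite horizon up to an arbitrarily small
    probability [d]; outside [jumps], [Z J] is within [2 * eps J] of it. *)
Lemma often_below_upper q J : pr P (often_below q) = 1 ->
  1 - 2 * eps J <= pr P [set w | Z J w <= q + 2 * eps J].
Proof.
move=> q1; have mO := tail_event_measurable (@often_below_tail q).
pose F n : set path_space := \bigcup_(i in [set i | (i <= n)%N]) [set w | Z (J + i) w <= q].
have mF n : measurable (F n).
  by apply: bigcup_measurable => i _; exact: (measurable_Z [set x | x <= q]).
have mZ := measurable_Z [set x | x <= q + 2 * eps J] J.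
have F1 : pr P (\bigcup_n F n) = 1.
  apply: (pr_full mO _ _ q1); first exact: bigcupT_measurable.
  move=> w /(_ J) [j Jj h]; exists (j - J)%N => //; exists (j - J)%N => /=; first exact: leqnn.
  by rewrite subnKC.
apply/ler_addgt0Pr => d d0.
have [|n hn] := pr_continuity_below mF _ F1 d0.
  by move=> n w [i /= ik h]; exists i => //=; exact: leqW.
have : pr P (F n) <= pr P ([set w | Z J w <= q + 2 * eps J] `|` jumps J n).
  apply: pr_le => //; first by apply: measurableU => //; exact: measurable_jumps.
  move=> w [i /= ik h]; have [jw|jw] := pselect (jumps J n w); [by right|left].
  have ji : ~ jumps J i w by move=> /(jumps_sub ik).
  by have := no_jumps ji; rewrite /= ler_norml => /andP[_]; lra.
move=> /le_trans/(_ (pr_setU_le _ mZ (measurable_jumps J n))).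
have := pr_jumps J n; lra.
Qed.

(** Outside [often_below q], all values from some time on exceed [q], and one of them is compared
    with [Z J]. *)
Lemma often_below_lower q J : pr P (often_below q) = 0 ->
  1 - 2 * eps J <= pr P [set w | q - 2 * eps J <= Z J w].
Proof.
move=> q0; have mO := tail_event_measurable (@often_below_tail q).
pose F n : set path_space := \bigcap_(i in [set i | (n <= i)%N]) [set w | q < Z (J + i) w].
have mF n : measurable (F n).
  apply: bigcap_measurable; first by exists n => /=.
  by move=> i _; exact: (measurable_Z [set x | q < x]).
have mZ := measurable_Z [set x | q - 2 * eps J <= x] J.
have F1 : pr P (\bigcup_n F n) = 1.
  apply: (@pr_full (~` often_below q)).
  - exact: measurableC.
  - exact: bigcupT_measurable.
  - move=> w; rewrite /often_below /= => /existsNP[j0 h].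
    exists j0 => // i /= ji; rewrite ltNge; apply/negP => hz; apply: h.
    by exists (J + i)%N => //; apply: leq_trans ji _; exact: leq_addl.
  - by rewrite pr_setC // q0 subr0.
apply/ler_addgt0Pr => d d0.
have [|n hn] := pr_continuity_below mF _ F1 d0.
  by move=> n w h i /= ni; apply: h => /=; exact: ltnW.
have : pr P (F n) <= pr P ([set w | q - 2 * eps J <= Z J w] `|` jumps J n).
  apply: pr_le => //; first by apply: measurableU => //; exact: measurable_jumps.
  move=> w /(_ n (leqnn n)) /= h; have [jw|jw] := pselect (jumps J n w); [by right|left].
  by have := no_jumps jw; rewrite /= ler_norml => /andP[+ _]; lra.
move=> /le_trans/(_ (pr_setU_le _ mZ (measurable_jumps J n))).
have := pr_jumps J n; lra.
Qed.

Lemma eps_le J : eps J <= J.+1%:R^-1.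
Proof.
rewrite /eps exprVn lef_pV2 ?posrE ?exprn_gt0 ?ltr0n // -natrX ler_nat.
by elim: J => // J IH; rewrite expnS; lia.
Qed.

Lemma variance_le J : exists k, expect y (k + m) (fun t => (g k t - expect y m f) ^+ 2) <= 25 / J.+1%:R.
Proof.
exists (fast J); set k := fast J; set n := (k + m)%N.
(* The supremum [c] of [S] plays the role of the almost sure limit of [Z]. *)
pose S := [set q : R | pr P (often_below q) = 0].
have S1 : S (-1).
  rewrite /S /= (_ : often_below _ = set0) ?pr0 //; apply/seteqP; split=> // w /(_ 0%N) [j _].
  by have /andP[] := Z01 j w; lra.
have ubS : ubound S 1.
  move=> q Sq; rewrite leNgt; apply/negP => q1; move: Sq; rewrite /S /=.
  rewrite (_ : often_below _ = setT) ?prT; first by move/eqP; rewrite oner_eq0.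
  apply/seteqP; split=> // w _ j0; exists j0 => //.
  by have /andP[] := Z01 j0 w; lra.
have hS : has_sup S by split; [exists (-1)|exists 1].
set c := sup S.
have c1 : c <= 1 by apply: ge_sup ubS; exists (-1).
have c0 : -1 <= c by apply: ub_le_sup => //; exists 1.
have e0 := eps_gt0 J.
(* One [eps J] separates [q] from the supremum, two bound the later jumps. *)
pose r := 3 * eps J.
have up : 1 - 2 * eps J <= pr P [set w | Z J w <= c + r].
  have -> : c + r = (c + eps J) + 2 * eps J by rewrite /r; ring.
  apply: often_below_upper; have [h|//] := often_below_01 (c + eps J).
  have : c + eps J <= c by apply: ub_le_sup => //; exists 1.
  lra.
have lo : 1 - 2 * eps J <= pr P [set w | c - r <= Z J w].
  have [q Sq qc] := sup_adherent e0 hS.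
  apply: le_trans (often_below_lower J Sq) _.
  apply: pr_le; [exact: (measurable_Z [set x | q - 2 * eps J <= x])|exact: (measurable_Z [set x | c - r <= x])|].
  by move=> w /=; rewrite /r -/c in qc *; lra.
pose bad (t : remy_tree) := ~~ (c - r <= g k t <= c + r).
have mu := measurable_Z [set x | x <= c + r] J.
have ml := measurable_Z [set x | c - r <= x] J.
have pbad : pr P [set w | bad (coord_process n w)] <= 4 * eps J.
  have mb := @measurable_event n (fun t => bad t).
  have := pr_setU_le P (measurableC mu) (measurableC ml); rewrite !pr_setC // => h.
  have : pr P [set w | bad (coord_process n w)] <=
     pr P (~` [set w | Z J w <= c + r] `|` ~` [set w | c - r <= Z J w]).
    apply: pr_le => //; first by apply: measurableU; exact: measurableC.
    by move=> w /=; rewrite /bad negb_and => /orP[/negP h'|/negP h']; [right|left].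
  by lra.
have [Z0 Z1] : (forall t, 0 <= g k t) /\ (forall t, g k t <= 1).
  by split=> t; have /andP[] := g01 k t.
(* Outside [bad] the deviation is at most [r]; on [bad], of probability at most [4 * eps J], it is
   at most 2, as [g k] lies in [0, 1] and [c] in [-1, 1]. *)
have step : expect y n (fun t => (g k t - c) ^+ 2) <= r ^+ 2 + 4 * (4 * eps J).
  apply: (@le_trans _ _ (expect y n (fun t => r ^+ 2 + 4 * (bad t)%:R))).
    apply: expect_le => // t _; have := Z0 t; have := Z1 t => h1 h0.
    have sq (x b : R) : - b <= x <= b -> x ^+ 2 <= b ^+ 2.
      move=> /andP[x1 x2]; rewrite -subr_ge0 subr_sqr mulr_ge0 //; lra.
    have [bt|] := boolP (bad t).
      have h4 : (g k t - c) ^+ 2 <= 2 ^+ 2 by apply: sq; lra.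
      by rewrite mulr1; have := sqr_ge0 r; lra.
    by rewrite /bad negbK mulr0 addr0 => h; apply: sq; lra.
  rewrite expectD (expect_cst _ _ (r ^+ 2)) (expect1 Hy) mulr1 lerD2l expectZ ler_wpM2l //.
  by rewrite (expect_pr Hy MC) -pr_event.
(* Among all constants, the mean minimizes the expected squared deviation. *)
have var : expect y n (fun t => (g k t - expect y m f) ^+ 2) <= expect y n (fun t => (g k t - c) ^+ 2).
  have mean : expect y n (g k) = expect y m f by exact: expect_iter_backward.
  rewrite (expect_variance Hy) ?mean //.
  rewrite (@expect_ext _ _ _ (fun t => (g k t - c) ^+ 2) (fun t => g k t ^+ 2 + (- 2 * c * g k t + c ^+ 2))); last by move=> t _; ring.
  rewrite !expectD expectZ (expect_cst _ _ (c ^+ 2)) (expect1 Hy) mean.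
  by have := sqr_ge0 (expect y m f - c); lra.
apply: le_trans var (le_trans step _).
have e1 : eps J <= 1 by rewrite /eps exprn_ile1 // ?invr_ge0 // invf_le1 ?ler1n.
(* 9 [eps J ^+ 2] + 16 [eps J], with [eps J] at most 1. *)
apply: le_trans (_ : 25 * eps J <= _); first by rewrite /r; nra.
by rewrite ler_pM2l ?ltr0n // eps_le.
Qed.

(** One time with small variance is enough, since the second moments decrease and the mean is
    constant. *)
Lemma variance_vanishes (d : R) : 0 < d -> exists N, forall n, (N <= n)%N ->
  expect y n (fun t => (iter (n - m) (@backward_op R) f t - expect y m f) ^+ 2) <= d.
Proof.
move=> d0.
have [J HJ] : exists J, 25 / J.+1%:R <= d.
  exists (Num.trunc (25 / d)); rewrite ler_pdivrMr ?ltr0n // -ler_pdivrMl // mulrC.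
  exact/ltW/truncnS_gt.
have [k Hk] := variance_le J; exists (k + m)%N => n kn.
have E : (n = (n - m - k) + k + m)%N by lia.
have E' : (n - m = (n - m - k) + k)%N by lia.
rewrite E' {1}E; apply: le_trans (le_trans Hk HJ).
rewrite !(expect_variance Hy); try by rewrite (expect_iter_backward Hy).
by rewrite lerD2r; exact: second_moment_noninc.
Qed.
End Concentration.

(** * The correspondence *)

Section Final.
Context (R : realType).

(** For the indicator of [s], the iterated average at [t] is [level_prob R m] times the kernel K(s,
    t). *)
Lemma kernel_variance_vanishes (P : probability path_space R) y s (d : R) :
  normalized_harmonic R y -> markov_chain P coord_process aleph (htransform y) ->
  tail_trivial P coord_process -> 0 < d ->
  exists N, forall n, (N <= n)%N -> expect y n (fun t => (density_ratio R s t - y s) ^+ 2) <= d.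
Proof.
move=> Hy MC TT d0; set m := (nleaves s - 2)%N.
pose f := fun v => (v == s)%:R : R.
have f01 v : 0 <= f v <= 1 by rewrite /f; case: (_ == _) => /=; lra.
have w0 := level_prob_gt0 R m.
have d1 : 0 < level_prob R m ^+ 2 * d by rewrite mulr_gt0 ?exprn_gt0.
have [N HN] := variance_vanishes Hy MC TT m f01 d1.
exists (maxn N m) => n; rewrite geq_max => /andP[Nn mn].
rewrite -(ler_pM2l (_ : 0 < level_prob R m ^+ 2)) ?exprn_gt0 // -expectZ.
apply: le_trans (HN n Nn); rewrite le_eqVlt; apply/orP; left; apply/eqP.
apply: expect_ext => t; rewrite mem_level => /eqP tn.
rewrite expect_delta ?mem_level_nleaves // /density_ratio tn -/m.
have sg := nleaves_ge2 s.
have -> : (nleaves s <= n.+2)%N = true by rewrite /m in mn; lia.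
have -> : iter (n - m) (@backward_op R) f t = density R s t.
  by rewrite /density tn; congr (iter _ _ _ _); rewrite /m; lia.
by rewrite -exprMn mulrBr mulrC divfK // level_prob_neq0.
Qed.

Lemma kernel_variance_seq (P : probability path_space R) y (L : seq remy_tree) (d : R) :
  normalized_harmonic R y -> markov_chain P coord_process aleph (htransform y) ->
  tail_trivial P coord_process -> 0 < d ->
  exists N, forall n, (N <= n)%N -> expect y n (fun t => \sum_(s <- L) (density_ratio R s t - y s) ^+ 2) <= d.
Proof.
move=> Hy MC TT; elim: L d => [|s L IH] d d0.
  exists 0%N => n _; rewrite (@expect_ext _ _ _ _ (fun=> 0)); last by move=> t _; rewrite big_nil.
  by rewrite expect_cst mul0r ltW.
have d2 : 0 < d / 2 by rewrite divr_gt0.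
have [N1 H1] := IH _ d2; have [N2 H2] := kernel_variance_vanishes s Hy MC TT d2.
exists (maxn N1 N2) => n; rewrite geq_max => /andP[n1 n2].
rewrite (@expect_ext _ _ _ _ (fun t => (density_ratio R s t - y s) ^+ 2 + \sum_(s <- L) (density_ratio R s t - y s) ^+ 2)); last first.
  by move=> t _; rewrite big_cons.
by rewrite expectD; have := H1 n n1; have := H2 n n2; lra.
Qed.

(** If the mean of the summed squared deviations is small, some tree [t] of the level has a small
    sum, and K(s, t) is close to [y s] for all of the first [k] states at once. *)
Lemma tail_trivial_boundary (P : probability path_space R) y :
  normalized_harmonic R y -> markov_chain P coord_process aleph (htransform y) ->
  tail_trivial P coord_process -> doob_martin_boundary R y.
Proof.
move=> Hy MC TT; have [y0 _ _] := Hy.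
have ex k : exists t, (k <= nleaves t)%N /\ forall s, (pickle s < k)%N -> `|y s - density_ratio R s t| <= k.+1%:R^-1.
  pose L := pmap (fun i => unpickle i : option remy_tree) (iota 0 k).
  (* Half of the target: a mean of at least the whole target is then contradictory. *)
  have d0 : 0 < (k.+1%:R^-1 : R) ^+ 2 / 2 by rewrite divr_gt0 // exprn_gt0 // invr_gt0 ltr0n.
  have [N HN] := kernel_variance_seq L Hy MC TT d0.
  set n := maxn N k; have {}HN := HN n (leq_maxl _ _).
  have [t tn ht] : exists2 t, t \in level n & \sum_(s <- L) (density_ratio R s t - y s) ^+ 2 <= k.+1%:R^-1 ^+ 2.
    apply: contrapT => h.
    have : expect y n (fun=> k.+1%:R^-1 ^+ 2) <= expect y n (fun t => \sum_(s <- L) (density_ratio R s t - y s) ^+ 2).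
      apply: expect_le => // t tn; rewrite leNgt; apply/negP => /ltW ht; apply: h; by exists t.
    rewrite expect_cst (expect1 Hy) mulr1 => h'; move: (le_trans h' HN) d0.
    by move: (k.+1%:R^-1 ^+ 2) => x; lra.
  exists t; split; first by move: tn; rewrite mem_level /n => /eqP ->; have := leq_maxr N k; lia.
  move=> s sk; have sL : s \in L.
    by rewrite mem_pmap; apply/mapP; exists (pickle s); rewrite ?mem_iota ?pickleK.
  have : (density_ratio R s t - y s) ^+ 2 <= k.+1%:R^-1 ^+ 2.
    apply: le_trans ht; rewrite (big_rem s) //= lerDl sumr_ge0 // => u _; exact: sqr_ge0.
  by rewrite -[X in X <= _]real_normK ?num_real // distrC ler_pXn2r ?nnegrE ?invr_ge0.
apply: (@sequence_boundary R y (fun k => projT1 (cid (ex k)))).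
  by move=> k; case: (cid (ex k)) => t [].
move=> s; apply/cvgrPdist_lt => e e0; near=> k.
have k1 : (pickle s < k)%N by near: k; exact: nbhs_infty_gt.
have k2 : k.+1%:R^-1 < e by near: k; exact: (near_infty_natSinv_lt (PosNum e0)).
by case: (cid (ex k)) => t [_ /= /(_ s k1) h]; apply: le_lt_trans h k2.
Unshelve. all: by end_near. Qed.

Lemma boundary_normalized (y : remy_tree -> R) : doob_martin_boundary R y ->
  normalized_harmonic R y /\ extreme_point (normalized_harmonic R) y.
Proof.
move=> /boundary_sequence [T [lvT Ty]].
have Hy := lim_normalized lvT Ty; have conc := lim_concentrated lvT Ty.
split=> //; split=> // a b u Ha Hb u01 yE; split.
  by apply: (concentrated_extreme Hy conc Ha Hb u01); rewrite yE.
apply: (concentrated_extreme Hy conc Hb Ha (u := 1 - u)); first by lra.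
by rewrite {1}yE; apply/funext => s; rewrite opprB addrCA subrr addr0 addrC.
Qed.

Lemma boundary_extremal_bridge (y : remy_tree -> R) : doob_martin_boundary R y ->
  extremal_bridge (bridge_of y) coord_process.
Proof.
move=> /boundary_normalized [Hy ext]; have MC := bridge_of_chain Hy.
by split; [exact: chain_is_bridge Hy MC|exact: extreme_tail_trivial Hy MC ext].
Qed.

(** Tail triviality depends on the law only: a tail event of paths pulls back to a tail event of [X]
    of the same probability. *)
Lemma extremal_bridge_boundary d (Omega : measurableType d) (P : probability Omega R)
    (X : nat -> Omega -> remy_tree) : extremal_bridge P X ->
  exists2 y, doob_martin_boundary R y & path_law (bridge_of y) coord_process = path_law P X.
Proof.
move=> [HX TT]; have [y Hy MX] := bridge_is_chain HX.
have MC := bridge_of_chain Hy; have [y0 _ _] := Hy.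
have law A : measurable A -> bridge_of y A = P [set x | A (fun n => X n x)].
  exact: (mc_law_unique (htransform_ge0 y0) MC MX).
exists y; last first.
  by apply/funext => -[A mA]; rewrite /path_law /= -law.
apply: (tail_trivial_boundary Hy MC) => A tA.
have eA := tail_sigma_event tA.
rewrite law; last exact: tail_event_measurable.
by apply: TT => m _; have [B mB ->] := eA m; exact: sigma_from_preimage.
Qed.

(** The one-dimensional marginals already determine [y], by [bridge_marginal]. *)
Lemma path_law_bridge_inj (y z : remy_tree -> R) : normalized_harmonic R y ->
  normalized_harmonic R z ->
  path_law (bridge_of y) coord_process = path_law (bridge_of z) coord_process -> y = z.
Proof.
move=> Hy Hz yz; apply/funext => s; set n := (nleaves s - 2)%N.
have := congr1 (fun l => l (exist _ _ (measurable_at n s))) yz.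
rewrite /path_law /= => /(congr1 fine).
rewrite -/(pr _ _) -/(pr (bridge_of z) _).
rewrite (bridge_marginal Hy (bridge_of_chain Hy)) (bridge_marginal Hz (bridge_of_chain Hz)).
by rewrite mem_level_nleaves => /(mulfI (level_prob_neq0 R n)).
Qed.
End Final.

Theorem corollary5p21 (R : realType) :
  (forall y : remy_tree -> R, doob_martin_boundary R y ->
     extreme_point (normalized_harmonic R) y /\
     (extreme_point (normalized_harmonic R) y <->
      extremal_bridge (bridge_of y) coord_process)) /\
  set_bij (doob_martin_boundary R) (extremal_bridge_laws R)
    (fun y => path_law (bridge_of y) coord_process).
Proof.
split.
  move=> y yb; have [_ ext] := boundary_normalized yb.
  (* At a boundary point both sides of the equivalence hold. *)
  by split=> //; split=> // _; exact: boundary_extremal_bridge.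
split.
- move=> y yb; exists _, _, (bridge_of y), coord_process.
  by split=> //; exact: boundary_extremal_bridge.
- move=> y z /set_mem /boundary_normalized [Hy _] /set_mem /boundary_normalized [Hz _].
  exact: path_law_bridge_inj.
- move=> _ [d [T [P [X [HX ->]]]]].
  by have [y yb yl] := extremal_bridge_boundary HX; exists y.
Qed.
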